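(* For every real $\alpha > 4$ there exists $s_0(\alpha)$ such that the following holds. Let $Q$ be a locally sparse generalized quadrangle of order $(s,t)$ with $s \geq s_0(\alpha)$ and $t \geq s(\log s)^{2\alpha}$. Then $Q$ has a maximal partial ovoid of size at most $s(\log s)^{\alpha}$.
   Context: A generalized quadrangle of order $(s,t)$ (with $s,t\ge 2$) is a point-line incidence structure in which every point lies on $t+1$ lines, every line contains $s+1$ points, two distinct points lie on at most one common line, and for every point $x$ and line $\ell$ with $x\notin\ell$ there is a unique point $x'\in\ell$ and a unique line $\ell'$ such that $x$ and $x'$ both lie on $\ell'$. Two points are collinear if they lie on a common line. A partial ovoid is a set of points no two of which are collinear; it is maximal if it is not properly contained in another partial ovoid. The quadrangle is locally sparse if for every set of three points, the number of points collinear with all three of them is at most $s+1$. Here $\log$ is the natural logarithm. *)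

(* Defs.v *)
From mathcomp Require Import all_boot.
From Stdlib Require Import Reals.
Set Implicit Arguments. Unset Strict Implicit. Unset Printing Implicit Defensive.

Section GQ.
Variables (Pt Ln : finType) (I : Pt -> Ln -> bool).

(* x and y are collinear: they lie on a common line (every point is collinear with itself). *)
Definition collinear (x y : Pt) : bool := [exists l, I x l && I y l].

Definition is_GQ (s t : nat) : Prop :=
  [/\ (2 <= s) && (2 <= t),
      (forall x : Pt, #|[set l | I x l]| = t.+1),
      (forall l : Ln, #|[set x | I x l]| = s.+1),
      (forall x y : Pt, x != y -> #|[set l | I x l && I y l]| <= 1) &
      (forall (x : Pt) (l : Ln), ~~ I x l ->
         exists! p : Pt * Ln, [&& I p.1 l, I x p.2 & I p.1 p.2])].

Definition partial_ovoid (O : {set Pt}) : Prop :=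
  forall x y, x \in O -> y \in O -> x != y -> ~~ collinear x y.

Definition maximal_partial_ovoid (O : {set Pt}) : Prop :=
  partial_ovoid O /\ forall O' : {set Pt}, O \proper O' -> ~ partial_ovoid O'.

Definition locally_sparse (s : nat) : Prop :=
  forall a b c : Pt, a != b -> a != c -> b != c ->
    #|[set z | [&& collinear z a, collinear z b & collinear z c]]| <= s.+1.
End GQ.

(* Main.v *)
From HB Require Import structures.
From mathcomp Require Import all_boot zify.
From Stdlib Require Import Reals Lra Lia.
From Stdlib Require Znat.
Require Import Defs.
Set Implicit Arguments. Unset Strict Implicit. Unset Printing Implicit Defensive.

(** Fix three pairwise non-collinear points x, y, z, and write L = log s, M = 320 L^4.  The ovoid
is built in three random stages, one per point; points on distinct lines through a fixed point
are never collinear, so each stage produces a partial ovoid for free.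

Stage 1 selects points S on the lines through x, at a rate for which a point off x^perp stays
uncovered with probability about sM/t.  Stage 2 selects points T on the lines through y among
those not covered by S, so that the set W of points still uncovered has density about M/t.
Stage 3 selects points R of W on the lines through z.  A point v of W off z^perp has about M
neighbours in the intersection of W and z^perp, and each line through z carries only O(log s)
points of W, so R covers v.  Hence a maximal partial ovoid containing S, T and R has all its other
points in the intersection of W and z^perp, up to x and y.  That intersection has size O(sM): the
only points of z^perp never exposed to stages 1 and 2 are those of {x,y,z}^perp, and local
sparsity leaves at most s+1 of them.

Concentration is proved by processing the lines one at a time: a weighted exponential moment of
the number of surviving neighbours decreases in expectation as long as no single point is
collinear with survivors of large total weight.  In stage 1 local sparsity bounds that weight
outright; in stage 2 it is controlled by a moment of order about log s.  Double counting with
local sparsity also gives t <= 2 s^2, so that all union bounds are over polynomially many events. *)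

(** Two thinning stages are needed because a stage centred at x gives no control over {x,z}^perp,
    whose t+1 points may be far too many. With a second centre y each stage thins what the other one
    misses. This fixes the rate of stage 1: the points of {y,z}^perp off x^perp, which stage 2 does
    not control, must drop from about t to O(sM) in stage 1 alone.

    The powers of L come from the accuracy required. Stage 2 has survival probability about 1/s,
    that is, an exponent near L, so the degrees it uses must be known up to a factor 1 + O(1/L) for
    that exponent to be known up to a constant. Stage 1 must deliver these degrees. Its own exponent
    is at most L, so a relative error 1/L in survival allows only a relative error eta of order
    1/L^2 in the exponent. A deviation by the fraction 1/(2L) then has probability exp(-c eta M/L),
    which must beat exp(-10L); hence M of order L^4 and alpha > 4.

    A survivor count at a point matters only if that point is itself uncovered. The conditioning is
    done by deleting its neighbours from the lines; this also keeps the selected points distinct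
    from it, as local sparsity requires. *)

(** * Sums and products of reals as big operators *)

Fact RplusA : associative Rplus.
Proof. by move=> x y z; rewrite Rplus_assoc. Qed.
Fact Rplus0x : left_id 0%R Rplus.
Proof. exact: Rplus_0_l. Qed.
HB.instance Definition _ := Monoid.isComLaw.Build R 0%R Rplus RplusA Rplus_comm Rplus0x.
Fact RmultA : associative Rmult.
Proof. by move=> x y z; rewrite Rmult_assoc. Qed.
HB.instance Definition _ :=
  Monoid.isComLaw.Build R 1%R Rmult RmultA Rmult_comm Rmult_1_l.
HB.instance Definition _ :=
  Monoid.isMulLaw.Build R 0%R Rmult Rmult_0_l Rmult_0_r.
Fact RmultDl : left_distributive Rmult Rplus.
Proof. exact: Rmult_plus_distr_r. Qed.
Fact RmultDr : right_distributive Rmult Rplus.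
Proof. exact: Rmult_plus_distr_l. Qed.
HB.instance Definition _ :=
  Monoid.isAddLaw.Build R Rmult Rplus RmultDl RmultDr.

Local Open Scope R_scope.

Reserved Notation "\rsum_ ( i <- r ) F"
  (at level 36, F at level 36, i, r at level 50,
   format "'[' \rsum_ ( i  <-  r ) '/  '  F ']'").
Reserved Notation "\rsum_ ( i <- r | P ) F"
  (at level 36, F at level 36, i, r at level 50,
   format "'[' \rsum_ ( i  <-  r  |  P ) '/  '  F ']'").
Reserved Notation "\rsum_ ( i 'in' A ) F"
  (at level 36, F at level 36, i, A at level 50,
   format "'[' \rsum_ ( i  'in'  A ) '/  '  F ']'").
Reserved Notation "\rsum_ ( i 'in' A | P ) F"
  (at level 36, F at level 36, i, A at level 50,
   format "'[' \rsum_ ( i  'in'  A  |  P ) '/  '  F ']'").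
Notation "\rsum_ ( i <- r ) F" := (\big[Rplus/0%R]_(i <- r) F%R) : R_scope.
Notation "\rsum_ ( i <- r | P ) F" := (\big[Rplus/0%R]_(i <- r | P%B) F%R) : R_scope.
Notation "\rsum_ ( i 'in' A ) F" := (\big[Rplus/0%R]_(i in A) F%R) : R_scope.
Notation "\rsum_ ( i 'in' A | P ) F" := (\big[Rplus/0%R]_(i in A | P%B) F%R) : R_scope.

Definition ind (b : bool) : R := if b then 1 else 0.

Lemma ind_ge0 b : 0 <= ind b.
Proof. by case: b => /=; lra. Qed.

Lemma ind_le1 b : ind b <= 1.
Proof. by case: b => /=; lra. Qed.

Lemma indM a b : ind (a && b) = ind a * ind b.
Proof. by case: a; case: b => /=; lra. Qed.

Section Sums.
Variable I : Type.
Implicit Types (r : seq I) (P : pred I) (F G : I -> R).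

Lemma rsum_le r P F G : (forall i, P i -> F i <= G i) ->
  \rsum_(i <- r | P i) F i <= \rsum_(i <- r | P i) G i.
Proof. by move=> FG; elim/big_ind2: _ => //; [lra | move=> *; lra]. Qed.

Lemma rsum_ge0 r P F : (forall i, P i -> 0 <= F i) ->
  0 <= \rsum_(i <- r | P i) F i.
Proof. by move=> F0; elim/big_ind: _ => //; [lra | move=> *; lra]. Qed.

Lemma rsum_distr r P F c :
  c * \rsum_(i <- r | P i) F i = \rsum_(i <- r | P i) (c * F i).
Proof. exact: big_distrr. Qed.

Lemma rsum_distl r P F c :
  (\rsum_(i <- r | P i) F i) * c = \rsum_(i <- r | P i) (F i * c).
Proof. exact: big_distrl. Qed.

Lemma rsum_add r P F G :
  \rsum_(i <- r | P i) (F i + G i) = \rsum_(i <- r | P i) F i + \rsum_(i <- r | P i) G i.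
Proof. exact: big_split. Qed.

Lemma rsum_const r P c : \rsum_(i <- r | P i) c = INR (count P r) * c.
Proof.
elim: r => [|i r IH]; first by rewrite big_nil /=; lra.
rewrite big_cons /= IH; case: (P i); rewrite ?add0n // add1n S_INR; lra.
Qed.

Lemma INR_sum r P (f : I -> nat) :
  INR (\sum_(i <- r | P i) f i) = \rsum_(i <- r | P i) INR (f i).
Proof. by elim/big_ind2: _ => // a b c d <- <-; rewrite plus_INR. Qed.

Lemma rprod_ge0 r P F : (forall i, P i -> 0 <= F i) ->
  0 <= \big[Rmult/1]_(i <- r | P i) F i.
Proof.
move=> F0; elim/big_ind: _ => //; [lra | by move=> x y *; apply: Rmult_le_pos].
Qed.

Lemma rprod_le r P F G : (forall i, P i -> 0 <= F i <= G i) ->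
  \big[Rmult/1]_(i <- r | P i) F i <= \big[Rmult/1]_(i <- r | P i) G i.
Proof.
move=> FG; suff : 0 <= \big[Rmult/1]_(i <- r | P i) F i <= \big[Rmult/1]_(i <- r | P i) G i by case.
elim/big_ind2: _ => //; first by lra.
move=> a b c d [a0 ab] [c0 cd]; split; first exact: Rmult_le_pos.
by apply: Rmult_le_compat.
Qed.

Lemma rprod_exp r P F :
  \big[Rmult/1]_(i <- r | P i) exp (F i) = exp (\rsum_(i <- r | P i) F i).
Proof.
elim: r => [|i r IH]; first by rewrite !big_nil exp_0.
by rewrite !big_cons IH; case: (P i) => //; rewrite exp_plus.
Qed.

End Sums.

Section SetSums.
Variable T : finType.
Implicit Types (A B : {set T}) (F G : T -> R).

Lemma rsum_set_const A c : \rsum_(i in A) c = INR #|A| * c.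
Proof. by rewrite rsum_const cardE /enum_mem size_filter. Qed.

Lemma rsum_ind_card A B : \rsum_(i in A) ind (i \in B) = INR #|A :&: B|.
Proof.
rewrite -(Rmult_1_r (INR _)) -rsum_set_const.
rewrite [LHS](bigID (mem B)) /= [X in _ + X]big1 ?Rplus_0_r; last first.
  by move=> i /andP[_ /negbTE ->].
rewrite (eq_bigl (fun i => (i \in A) && (i \in B))).
  by apply: eq_big => [i|i /andP[_ ->]]; rewrite ?inE.
by [].
Qed.

Lemma rsum_setI A B F : \rsum_(i in A) (ind (i \in B) * F i) = \rsum_(i in A :&: B) F i.
Proof.
rewrite (bigID (mem B)) /= [X in _ + X]big1 ?Rplus_0_r; last first.
  by move=> i /andP[_ /negbTE ->]; rewrite /ind; lra.
by apply: eq_big => [i|i /andP[_ ->]]; rewrite ?inE //= /ind; lra.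
Qed.

Lemma rsum_setD A B F :
  \rsum_(i in A :\: B) F i = \rsum_(i in A) F i - \rsum_(i in A :&: B) F i.
Proof.
suff -> : \rsum_(i in A) F i = \rsum_(i in A :&: B) F i + \rsum_(i in A :\: B) F i by lra.
by rewrite (big_setID B).
Qed.

Lemma rsum_ge_term A F i : (forall j, j \in A -> 0 <= F j) -> i \in A ->
  F i <= \rsum_(j in A) F j.
Proof.
move=> F0 iA; rewrite (bigD1 i) //=.
suff : 0 <= \rsum_(j in A | j != i) F j by lra.
by apply: rsum_ge0 => j /andP[/F0].
Qed.

Lemma rsum_subset A B F : A \subset B -> (forall j, j \in B -> 0 <= F j) ->
  \rsum_(j in A) F j <= \rsum_(j in B) F j.
Proof.
move=> AB F0; rewrite (big_setID A (A := B)) /= (setIidPr AB).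
suff : 0 <= \rsum_(j in B :\: A) F j by lra.
by apply: rsum_ge0 => j; rewrite inE => /andP[_ /F0].
Qed.

End SetSums.

(** * Elementary bounds on the exponential *)

Lemma exp_sub_le_1m h : 0 <= h <= / 2 -> exp (- (h * (1 + 2 * h))) <= 1 - h.
Proof.
move=> [h0 h2].
have h1 : 0 < 1 - h by lra.
have E : / (1 + h / (1 - h)) = 1 - h by field; lra.
rewrite -[X in _ <= X]E exp_Ropp; apply: Rinv_le_contravar.
  suff : 0 <= h / (1 - h) by lra.
  by apply: Rmult_le_pos => //; apply/Rlt_le/Rinv_0_lt_compat.
have := exp_ineq1_le (h * (1 + 2 * h)).
suff : h / (1 - h) <= h * (1 + 2 * h) by lra.
apply: (Rmult_le_reg_r (1 - h)) => //.
have -> : h / (1 - h) * (1 - h) = h by field; lra.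
have : 0 <= h * h * (1 - 2 * h) by apply: Rmult_le_pos; nra.
nra.
Qed.

Lemma one_minus_le_exp x : 1 - x <= exp (- x).
Proof. by have := exp_ineq1_le (- x); lra. Qed.

Lemma exp_le x y : x <= y -> exp x <= exp y.
Proof. by case=> [/exp_increasing|->]; lra. Qed.

(** For z <= 0 this follows from e^z <= 1/(1-z), and for small positive z from the same bound at
    z/2, squared. Negative z is kept because the upper tail runs the moment argument with a negative
    [lam]. *)
Lemma exp_le_quadratic z : z <= / 4 -> exp z <= 1 + z + z * z.
Proof.
move=> z4.
have exp_inv x : x < 1 -> exp x <= / (1 - x).
  move=> x1; rewrite -[x in exp x]Ropp_involutive exp_Ropp.
  by apply: Rinv_le_contravar; [lra | exact: one_minus_le_exp].
case: (Rle_dec z 0) => z0.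
  apply: Rle_trans (exp_inv _ _) _; first by lra.
  apply: (Rmult_le_reg_r (1 - z)); first by lra.
  rewrite Rinv_l; last by lra.
  have : 0 <= z * z by nra.
  nra.
have -> : exp z = exp (z / 2) * exp (z / 2) by rewrite -exp_plus; f_equal; lra.
have h := exp_inv (z / 2) ltac:(lra).
have e0 := exp_pos (z / 2).
set w := / (1 - z / 2) in h.
have w1 : w * (1 - z / 2) = 1 by rewrite /w; field; lra.
have w0 : 0 < w by lra.
have : w * w <= 1 + z + z * z.
  apply: (Rmult_le_reg_r ((1 - z / 2) * (1 - z / 2))); first by nra.
  have -> : w * w * ((1 - z / 2) * (1 - z / 2)) = (w * (1 - z / 2)) * (w * (1 - z / 2)) by ring.
  rewrite w1.
  (* (1 + z + z^2)(1 - z/2)^2 equals 1 + z^2 (1 - 3z)/4 + z^4/4. *)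
  have : 0 <= z * z * (1 - 3 * z) by apply: Rmult_le_pos; nra.
  have : 0 <= (z * z) * (z * z) by exact: Rle_0_sqr.
  nra.
nra.
Qed.

(** * Independent random selection from a list of sets *)

Section RandomSelection.
Variable T : finType.
Implicit Types (ls : seq {set T}) (S A B : {set T}) (F G : {set T} -> R).

(* Expectation of [F S], where [S] collects at most one point from each member [l] of [ls],
   independently, each point of [l] with probability [r]. *)
Fixpoint Ex (r : R) ls F : R :=
  if ls is l :: ls' then
    (1 - r * INR #|l|) * Ex r ls' F + r * \rsum_(u in l) Ex r ls' (fun S => F (u |: S))
  else F set0.

(** Contains the support of the selection. Together with the recursive [Ex] it replaces a
    probability space. *)
Fixpoint outcome ls S : Prop :=
  if ls is l :: ls' then
    outcome ls' S \/ exists u S', [/\ u \in l, outcome ls' S' & S = u |: S']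
  else S = set0.

Definition admissible (r : R) ls := 0 <= r /\ forall l, l \in ls -> r * INR #|l| <= 1.

Definition restrict ls B := [seq l :&: B | l <- ls].

Lemma admissible_cons r l ls : admissible r (l :: ls) ->
  [/\ 0 <= r, 0 <= 1 - r * INR #|l| & admissible r ls].
Proof.
case=> r0 H; split=> //; first by have := H l (mem_head _ _); lra.
by split=> // l' l'ls; apply: H; rewrite inE l'ls orbT.
Qed.

Lemma Ex_ext r ls F G : (forall S, F S = G S) -> Ex r ls F = Ex r ls G.
Proof.
elim: ls F G => [|l ls IH] F G FG /=; first exact: FG.
by rewrite (IH _ _ FG); congr (_ + _ * _); apply: eq_bigr => u _; apply: IH.
Qed.

Lemma Ex_le r ls F G : admissible r ls -> (forall S, F S <= G S) -> Ex r ls F <= Ex r ls G.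
Proof.
elim: ls F G => [|l ls IH] F G /=; first by move=> _; apply.
move=> /admissible_cons[r0 r1 adm] FG; apply: Rplus_le_compat.
  by apply: Rmult_le_compat_l => //; exact: IH.
by apply: Rmult_le_compat_l => //; apply: rsum_le => u _; apply: IH.
Qed.

Lemma Ex_const r ls c : Ex r ls (fun=> c) = c.
Proof.
elim: ls => //= l ls IH; rewrite IH rsum_set_const; ring.
Qed.

Lemma ExD r ls F G : Ex r ls (fun S => F S + G S) = Ex r ls F + Ex r ls G.
Proof.
elim: ls F G => //= l ls IH F G.
rewrite IH (eq_bigr _ (fun u _ => IH (fun S => F (u |: S)) (fun S => G (u |: S)))).
rewrite rsum_add; ring.
Qed.

Lemma ExZ r ls c F : Ex r ls (fun S => c * F S) = c * Ex r ls F.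
Proof.
elim: ls F => //= l ls IH F.
rewrite IH (eq_bigr _ (fun u _ => IH (fun S => F (u |: S)))) -rsum_distr; ring.
Qed.

Lemma Ex_sum r ls (J : Type) (js : seq J) (P : pred J) (F : J -> {set T} -> R) :
  Ex r ls (fun S => \rsum_(j <- js | P j) F j S) = \rsum_(j <- js | P j) Ex r ls (F j).
Proof.
elim: js => [|j js IH].
  rewrite big_nil (@Ex_ext r ls _ (fun=> 0)) ?Ex_const // => S; by rewrite big_nil.
rewrite big_cons -IH; case: ifP => Pj; last first.
  by apply: Ex_ext => S; rewrite big_cons Pj.
by rewrite -ExD; apply: Ex_ext => S; rewrite big_cons Pj.
Qed.

(** First-moment method: [Ex] is a convex combination of its branches, so at each line some branch
    keeps the expectation below [c]. *)
Lemma Ex_outcome r ls F c : admissible r ls -> Ex r ls F < c ->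
  exists2 S, outcome ls S & F S < c.
Proof.
elim: ls F => [|l ls IH] F /=; first by move=> _ Fc; exists set0.
move=> /admissible_cons[r0 r1 adm] Hc.
case: (Rlt_dec (Ex r ls F) c) => [/(IH _ adm)[S oS FS]|Hn].
  by exists S => //; left.
case: (boolP [exists u in l, if Rlt_dec (Ex r ls (fun S => F (u |: S))) c then true else false]).
  case/exists_inP=> u ul; case: Rlt_dec => // /(IH _ adm)[S oS FS] _.
  by exists (u |: S) => //; right; exists u, S.
move=> /exists_inPn Hu; exfalso.
suff : c <= (1 - r * INR #|l|) * Ex r ls F + r * \rsum_(u in l) Ex r ls (fun S => F (u |: S)) by lra.
have -> : c = (1 - r * INR #|l|) * c + r * \rsum_(u in l) c by rewrite rsum_set_const; ring.
apply: Rplus_le_compat; apply: Rmult_le_compat_l => //; first by lra.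
by apply: rsum_le => u /Hu; case: Rlt_dec => // *; lra.
Qed.

Lemma Ex_disjoint r ls B : admissible r ls ->
  Ex r ls (fun S => ind [disjoint S & B]) <= exp (- (r * \rsum_(l <- ls) INR #|l :&: B|)).
Proof.
elim: ls => [|l ls IH] /=.
  by move=> _; rewrite big_nil Rmult_0_r Ropp_0 exp_0; exact: ind_le1.
move=> /admissible_cons[r0 r1 adm]; rewrite big_cons.
set E := Ex r ls _; have {}IH : E <= _ := IH adm.
have E0 : 0 <= E by rewrite -(Ex_const r ls 0); apply: Ex_le => // S; exact: ind_ge0.
have -> : \rsum_(u in l) Ex r ls (fun S => ind [disjoint u |: S & B]) = INR #|l :\: B| * E.
  rewrite (eq_bigr (fun u => ind (u \in ~: B) * E)); last first.
    move=> u _; rewrite -ExZ; apply: Ex_ext => S.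
    by rewrite disjoints_subset subUset sub1set indM disjoints_subset.
  by rewrite -rsum_distl rsum_ind_card setDE.
have cl : INR #|l| = INR #|l :&: B| + INR #|l :\: B| by rewrite -(cardsID B l) plus_INR.
have -> : (1 - r * INR #|l|) * E + r * (INR #|l :\: B| * E) = (1 - r * INR #|l :&: B|) * E.
  rewrite cl; ring.
set k := INR #|l :&: B|.
have -> : - (r * (k + \rsum_(j <- ls) INR #|j :&: B|)) =
  - (r * k) + - (r * \rsum_(j <- ls) INR #|j :&: B|) by ring.
rewrite exp_plus; apply: Rmult_le_compat => //; last exact: one_minus_le_exp.
have : 0 <= r * INR #|l :\: B| by apply: Rmult_le_pos => //; exact: pos_INR.
have : r * INR #|l| = r * k + r * INR #|l :\: B| by rewrite cl /k; ring.
lra.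
Qed.

Lemma Ex_card r ls : admissible r ls ->
  Ex r ls (fun S => INR #|S|) <= r * \rsum_(l <- ls) INR #|l|.
Proof.
elim: ls => [|l ls IH] /=; first by move=> _; rewrite big_nil cards0 /=; lra.
move=> /admissible_cons[r0 r1 adm]; rewrite big_cons.
set E := Ex r ls _; have {}IH : E <= _ := IH adm.
have : \rsum_(u in l) Ex r ls (fun S => INR #|u |: S|) <= INR #|l| * (E + 1).
  rewrite -rsum_set_const; apply: rsum_le => u _.
  rewrite -[X in _ <= _ + X](Ex_const r ls 1) -ExD; apply: Ex_le => // S.
  rewrite -S_INR; apply: le_INR; rewrite cardsU1; case: (u \notin S); lia.
set X := bigop _ _ _ => HX.
have : r * X <= r * (INR #|l| * (E + 1)) by exact: Rmult_le_compat_l.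
have : (1 - r * INR #|l|) * E = E - r * (INR #|l| * E) by ring.
have : r * (INR #|l| * (E + 1)) = r * (INR #|l| * E) + r * INR #|l| by ring.
rewrite Rmult_plus_distr_l; lra.
Qed.

Lemma restrict_admissible r ls B : admissible r ls -> admissible r (restrict ls B).
Proof.
case=> r0 H; split=> // _ /mapP[l lls ->]; apply: Rle_trans (H _ lls).
by apply: Rmult_le_compat_l => //; apply/le_INR/leP/subset_leq_card/subsetIl.
Qed.

Lemma restrictI ls A B : restrict (restrict ls A) B = restrict ls (A :&: B).
Proof. by rewrite /restrict -map_comp; apply: eq_map => l /=; rewrite setIA. Qed.

(* The probability of the deleted points is transferred to selecting nothing. *)
Lemma Ex_restrict r ls B F : admissible r ls -> (forall S, 0 <= F S) ->
  Ex r ls (fun S => ind [disjoint S & B] * F S) <= Ex r (restrict ls (~: B)) F.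
Proof.
elim: ls F => [|l ls IH] F /=.
  by move=> _ F0; have := F0 set0; case: [disjoint _ & _] => /=; lra.
move=> /admissible_cons[r0 r1 adm] F0.
have adm' := restrict_admissible (~: B) adm.
have E0 G : (forall S, 0 <= G S) -> 0 <= Ex r (restrict ls (~: B)) G.
  by move=> G0; rewrite -(Ex_const r (restrict ls (~: B)) 0); exact: Ex_le.
apply: Rplus_le_compat.
  apply: Rmult_le_compat => //; [| |exact: IH].
    rewrite -(Ex_const r ls 0); apply: Ex_le => // S.
    by apply: Rmult_le_pos; [exact: ind_ge0 | exact: F0].
  apply/Rplus_le_compat_l/Ropp_le_contravar/Rmult_le_compat_l => //.
  exact/le_INR/leP/subset_leq_card/subsetIl.
apply: Rmult_le_compat_l => //; rewrite -rsum_setI; apply: rsum_le => u _.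
rewrite inE; case uB: (u \in B) => /=.
  rewrite Rmult_0_l (@Ex_ext r ls _ (fun=> 0)) ?Ex_const; first by lra.
  move=> S; rewrite disjoints_subset subUset sub1set inE uB /=; lra.
rewrite Rmult_1_l; apply: Rle_trans (IH _ adm _) => [|S]; last exact: F0.
apply: Ex_le => // S.
by rewrite !disjoints_subset subUset sub1set inE uB /=; apply: Rle_refl.
Qed.

Lemma outcome_subset ls S : outcome ls S -> forall u, u \in S -> exists2 l, l \in ls & u \in l.
Proof.
elim: ls S => [|l ls IH] S /=; first by move=> -> u; rewrite inE.
case=> [/IH H u /H[l' l'ls ul']|[v [S' [vl /IH H ->]]] u].
  by exists l'; rewrite // inE l'ls orbT.
rewrite !inE => /orP[/eqP ->|/H[l' l'ls ul']]; first by exists l; rewrite ?inE ?eqxx.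
by exists l'; rewrite // inE l'ls orbT.
Qed.

Lemma outcome_pairwise (e : rel T) ls S : symmetric e ->
  pairwise (fun l l' : {set T} => [forall u in l, forall v in l', ~~ e u v]) ls ->
  outcome ls S -> forall u v, u \in S -> v \in S -> u != v -> ~~ e u v.
Proof.
move=> eC; elim: ls S => [|l ls IH] S /=; first by move=> _ -> u v; rewrite inE.
case/andP=> /allP Hl pw [/(IH _ pw) // | [w [S' [wl oS' ->]]] u v].
have cross a : a \in S' -> ~~ e w a.
  case/(outcome_subset oS')=> l' /Hl /forall_inP/(_ w wl)/forall_inP H al'.
  exact: H.
rewrite !inE => /orP[/eqP ->|uS] /orP[/eqP ->|vS]; rewrite ?eqxx //.
- by move=> _; exact: cross.
- by move=> _; rewrite eC; exact: cross.
- exact: (IH _ pw oS').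
Qed.

End RandomSelection.

(** * Concentration of the number of survivors *)

Section Tail.
Variables (T : finType) (N : T -> {set T}).
Hypothesis N_sym : forall u a, (u \in N a) = (a \in N u).
Implicit Types (ls : seq {set T}) (S A C J : {set T}).

Definition nbr S := \bigcup_(u in S) N u.

Lemma nbr0 : nbr set0 = set0.
Proof. exact: big_set0. Qed.

Lemma nbrU1 u S : nbr (u |: S) = N u :|: nbr S.
Proof. by rewrite /nbr bigcup_setU big_set1. Qed.

Lemma disjoint_nbr S a : [disjoint S & N a] = (a \notin nbr S).
Proof.
apply/idP/idP.
  move=> /pred0P dis; apply/negP => /bigcupP[u uS]; rewrite -N_sym => ua.
  by have := dis u; rewrite /= uS ua.
move=> /negP nS; apply/pred0P => u /=; apply/negP => /andP[uS ua].
by apply: nS; apply/bigcupP; exists u; rewrite // -N_sym.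
Qed.

Lemma disjoint_nbr_sym S J : [disjoint S & nbr J] = [disjoint J & nbr S].
Proof.
wlog suff H : S J / [disjoint S & nbr J] -> [disjoint J & nbr S].
  by apply/idP/idP; exact: H.
rewrite !disjoints_subset => /subsetP H; apply/subsetP => a aJ.
rewrite inE -disjoint_nbr disjoints_subset; apply/subsetP => u /H; rewrite !inE.
by apply: contra => ua; apply/bigcupP; exists a.
Qed.

(* The [j]-element subsets of [C], each listed once per ordering. *)
Fixpoint chains j C : seq {set T} :=
  if j is j'.+1 then [seq a |: J | J <- chains j' C, a <- enum (C :\: J)] else [:: set0].

Lemma chainsP j C J : J \in chains j C -> #|J| = j /\ J \subset C.
Proof.
elim: j J => [|j IH] J /=; first by rewrite inE => /eqP ->; rewrite cards0 sub0set.
case/allpairsPdep=> J' [a [/IH[cJ' sJ'] + ->]].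
rewrite mem_enum inE => /andP[aJ' aC].
by rewrite cardsU1 aJ' cJ' subUset sub1set aC.
Qed.

Lemma big_chainsS j C (F : {set T} -> R) :
  \rsum_(J <- chains j.+1 C) F J = \rsum_(J <- chains j C) \rsum_(a in C :\: J) F (a |: J).
Proof. by rewrite big_allpairs_dep; apply: eq_bigr => J _; rewrite big_enum. Qed.

Lemma size_chains j C : INR (size (chains j C)) <= INR #|C| ^ j.
Proof.
elim: j => [|j IH] /=; first by lra.
have -> : INR (size (chains j.+1 C)) = \rsum_(J <- chains j.+1 C) 1.
  by rewrite rsum_const count_predT Rmult_1_r.
rewrite big_chainsS.
apply: (Rle_trans _ (\rsum_(J <- chains j C) INR #|C|)).
  apply: rsum_le => J _; rewrite rsum_set_const Rmult_1_r.
  exact/le_INR/leP/subset_leq_card/subsetDl.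
rewrite rsum_const count_predT Rmult_comm.
by apply: Rmult_le_compat_l => //; exact: pos_INR.
Qed.

(** The points of [J] are chosen one by one. Those already chosen carry weight at most
    [INR j * lam], so each new point ranges over a weight of at least [eta - INR j * lam]; this
    bound is kept fixed while the induction runs over k <= j. *)
Lemma chains_sum_ge (w : T -> R) lam eta j C A : 0 <= lam ->
  (forall a, a \in C -> 0 <= w a <= lam) -> 0 <= eta - INR j * lam ->
  eta <= \rsum_(a in C :&: A) w a ->
  (eta - INR j * lam) ^ j
    <= \rsum_(J <- chains j C) (ind (J \subset A) * \big[Rmult/1]_(a in J) w a).
Proof.
move=> lam0 w_le eta_ge eta_le; set x := _ - _ in eta_ge *.
suff H (k : nat) : (k <= j)%nat -> x ^ k <= \rsum_(J <- chains k C) (ind (J \subset A) * \big[Rmult/1]_(a in J) w a).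
  exact: H.
elim: k => [|k IH] kj.
  by rewrite /= big_seq1 sub0set big_set0 /=; lra.
rewrite big_chainsS /=.
apply: (Rle_trans _ (x * \rsum_(J <- chains k C) (ind (J \subset A) * \big[Rmult/1]_(a in J) w a))).
  by apply: Rmult_le_compat_l => //; apply: IH; exact: ltnW.
rewrite rsum_distr big_seq_cond [X in _ <= X]big_seq_cond.
apply: rsum_le => J; rewrite andbT => /chainsP[cJ sJ].
have -> : \rsum_(a in C :\: J) (ind (a |: J \subset A) * \big[Rmult/1]_(b in (a |: J)) w b)
   = (\rsum_(a in (C :\: J) :&: A) w a) * (ind (J \subset A) * \big[Rmult/1]_(a in J) w a).
  rewrite -rsum_setI rsum_distl; apply: eq_bigr => a; rewrite inE => /andP[aJ _].
  rewrite big_setU1 //= subUset sub1set indM; ring.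
apply: Rmult_le_compat_r.
  apply: Rmult_le_pos; first exact: ind_ge0.
  by apply: rprod_ge0 => a /(subsetP sJ)/w_le[].
have w0 a : a \in C -> 0 <= w a by move=> /w_le[].
rewrite setIC setIDA setIC rsum_setD.
suff : \rsum_(a in C :&: A :&: J) w a <= INR j * lam by rewrite /x; lra.
apply: (Rle_trans _ (\rsum_(a in J) lam)).
  apply: (Rle_trans _ (\rsum_(a in J) w a)).
    by apply: rsum_subset; [exact: subsetIr | move=> a /(subsetP sJ)/w0].
  by apply: rsum_le => a /(subsetP sJ)/w_le[].
rewrite rsum_set_const cJ; apply: Rmult_le_compat_r => //.
by apply: le_INR; lia.
Qed.

End Tail.

(** * The weighted exponential moment, one line at a time *)

Section ExponentialTail.
Variables (T : finType) (N : T -> {set T}).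
Hypothesis N_sym : forall u a, (u \in N a) = (a \in N u).
Variables (r lam beta : R).
Implicit Types (ls : seq {set T}) (S A C J : {set T}).

(** For [beta = 1] the product is the probability that no selection from the remaining lines [ls]
    covers [a]; [beta] leaves room for the second-order error of the exponential. *)
Definition wt ls a := lam * \big[Rmult/1]_(l <- ls) (1 - r * beta * INR #|l :&: N a|).

Definition mass ls A := \rsum_(a in A) wt ls a.

(** Expected total penalty: each line charges [b] for every candidate point [u], chosen or not,
    evaluated at the survivors present when that line is processed. *)
Fixpoint defect (b : {set T} -> seq {set T} -> T -> R) ls A : R :=
  if ls is l :: ls' then
    \rsum_(u in l) b A ls' u + ((1 - r * INR #|l|) * defect b ls' A
      + r * \rsum_(u in l) defect b ls' (A :\: N u))
  else 0.

Lemma wt_cons l ls a : wt (l :: ls) a = wt ls a * (1 - r * beta * INR #|l :&: N a|).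
Proof. rewrite /wt big_cons; ring. Qed.

(** Double counting of the pairs with [u] in [l] and [a] in [A :&: N u]. *)
Lemma mass_cons l ls A :
  mass (l :: ls) A = mass ls A - r * beta * \rsum_(u in l) mass ls (A :&: N u).
Proof.
have -> : \rsum_(u in l) mass ls (A :&: N u) = \rsum_(a in A) (INR #|l :&: N a| * wt ls a).
  rewrite (eq_bigr (fun u => \rsum_(a in A) (ind (a \in N u) * wt ls a))); last first.
    by move=> u _; rewrite rsum_setI.
  rewrite exchange_big; apply: eq_bigr => a _.
  rewrite -rsum_distl -rsum_ind_card; congr (_ * _).
  by apply: eq_bigr => u _; rewrite N_sym.
rewrite rsum_distr /mass.
have -> : \rsum_(a in A) wt (l :: ls) a =
   \rsum_(a in A) wt ls a + \rsum_(a in A) (- (r * beta * (INR #|l :&: N a| * wt ls a))).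
  rewrite -rsum_add; apply: eq_bigr => a _; rewrite wt_cons; ring.
suff -> : \rsum_(a in A) (- (r * beta * (INR #|l :&: N a| * wt ls a))) =
  (- 1) * \rsum_(a in A) (r * beta * (INR #|l :&: N a| * wt ls a)) by ring.
rewrite rsum_distr; apply: eq_bigr => a _; ring.
Qed.

(** Exactly what yields e^z <= 1 + z + z^2 <= 1 + [beta] z. Nonzero z must have the sign of
    [beta - 1], so [beta] lies above 1 for lower tails and below 1 for upper tails. *)
Definition tame z := z <= / 4 /\ z * z <= (beta - 1) * z.

(* One step multiplies the exponential moment by at most
   1 + r sum_u (e^{Z_u} - 1) <= exp (r beta sum_u Z_u), which the weights absorb. *)
Lemma exponential_tail b ls A : admissible r ls ->
  (forall A' ls' l u, A' \subset A -> {subset ls' <= ls} -> l \in ls -> u \in l ->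
     0 <= b A' ls' u /\ (tame (mass ls' (A' :&: N u)) \/ 1 <= b A' ls' u /\ 0 <= lam)) ->
  Ex r ls (fun S => exp (- (lam * INR #|A :\: nbr N S|)))
    <= exp (- mass ls A) + defect b ls A.
Proof.
elim: ls A => [|l ls IH] A /=.
  move=> _ _; rewrite nbr0 setD0.
  have -> : mass [::] A = lam * INR #|A|.
    rewrite /mass (eq_bigr (fun=> lam)) ?rsum_set_const; first by ring.
    by move=> a _; rewrite /wt big_nil; ring.
  by lra.
move=> adm; have [r0 r1 adm'] := admissible_cons adm => Hb.
have Hb' A' : A' \subset A -> Ex r ls (fun S => exp (- (lam * INR #|A' :\: nbr N S|)))
    <= exp (- mass ls A') + defect b ls A'.
  move=> A'A; apply: IH => // A2 ls' l' u A2A' sls l'ls ul'; apply: (Hb _ _ l') => //.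
  - exact: subset_trans A'A.
  - by move=> k /sls kls; rewrite inE kls orbT.
  - by rewrite inE l'ls orbT.
have D0 A' : A' \subset A -> 0 <= defect b ls A'.
  move: Hb; clear -r0 adm'; elim: ls A' adm' => [|k ls IH] A' /= adm'; first by lra.
  have [_ k1 adm2] := admissible_cons adm' => Hb A'A.
  have Hb2 : forall (A' : {set T}) (ls' : seq {set T}) (l0 : {set T}) (u : T),
    A' \subset A -> {subset ls' <= l :: ls} -> l0 \in l :: ls -> u \in l0 ->
    0 <= b A' ls' u /\ (tame (mass ls' (A' :&: N u)) \/ 1 <= b A' ls' u /\ 0 <= lam).
    move=> A2 ls' l' u A2A' sls l'ls ul'; apply: (Hb _ _ l') => //.
      by move=> m /sls; rewrite !inE => /orP[->|->]; rewrite ?orbT.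
    by move: l'ls; rewrite !inE => /orP[->|->]; rewrite ?orbT.
  apply: Rplus_le_le_0_compat.
    apply: rsum_ge0 => u uk; apply: (proj1 (Hb _ _ k u _ _ _ _)) => //.
      by move=> m mls; rewrite !inE mls !orbT.
    by rewrite !inE eqxx orbT.
  apply: Rplus_le_le_0_compat; apply: Rmult_le_pos => //; first exact: IH.
  apply: rsum_ge0 => u uk; apply: IH => //.
  exact: subset_trans (subsetDl _ _) A'A.
have sls : {subset ls <= l :: ls} by move=> k kls; rewrite inE kls orbT.
have Hl u : u \in l -> 0 <= b A ls u /\ (tame (mass ls (A :&: N u)) \/ 1 <= b A ls u /\ 0 <= lam).
  by move=> ul; apply: (Hb _ _ l) => //; exact: mem_head.
have sub u : A :\: N u \subset A by exact: subsetDl.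
have defect_ge0 : 0 <= (1 - r * INR #|l|) * defect b ls A + r * \rsum_(u in l) defect b ls (A :\: N u).
  apply: Rplus_le_le_0_compat; apply: Rmult_le_pos => //; first exact: D0.
  by apply: rsum_ge0 => u _; exact: D0.
have sumb_ge0 : 0 <= \rsum_(u in l) b A ls u by apply: rsum_ge0 => u /Hl[].
(* A penalty of at least 1 makes the claim trivial: with [lam] nonnegative the left side is at most
   1. Otherwise every class of this line is tame. *)
case: (boolP [exists u in l, if Rle_dec 1 (b A ls u) then if Rle_dec 0 lam then true else false else false]).
  case/exists_inP=> u ul; case: Rle_dec => // b1; case: Rle_dec => // lam0 _.
  apply: (Rle_trans _ 1).
    rewrite -[X in _ <= X](Ex_const r (l :: ls) 1).
    apply: (@Ex_le _ r (l :: ls)) => // S; rewrite -exp_0; apply: exp_le.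
    by have : 0 <= lam * INR #|A :\: nbr N S| by [apply: Rmult_le_pos => //; exact: pos_INR]; lra.
  have : b A ls u <= \rsum_(u in l) b A ls u by apply: rsum_ge_term => // v /Hl[].
  by have := exp_pos (- mass (l :: ls) A); lra.
move/exists_inPn => Hn.
have tm u : u \in l -> tame (mass ls (A :&: N u)).
  move=> ul; case: (Hl u ul) => _ [//|[b1 lam0]].
  by have := Hn u ul; case: Rle_dec => //; case: Rle_dec.
have {}Hn : forall u, u \in l -> Ex r ls (fun S => exp (- (lam * INR #|A :\: nbr N (u |: S)|)))
  <= exp (- mass ls A) * exp (mass ls (A :&: N u)) + defect b ls (A :\: N u).
  move=> u ul; rewrite -exp_plus.
  have -> : - mass ls A + mass ls (A :&: N u) = - mass ls (A :\: N u).
    by rewrite /mass rsum_setD; ring.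
  apply: Rle_trans (Hb' _ (sub u)); apply: Req_le; apply: Ex_ext => S.
  by rewrite nbrU1 setDDl.
have main : (1 - r * INR #|l|) * exp (- mass ls A) +
    r * \rsum_(u in l) (exp (- mass ls A) * exp (mass ls (A :&: N u)))
    <= exp (- mass (l :: ls) A).
  rewrite -rsum_distr mass_cons.
  set Z := fun u => mass ls (A :&: N u).
  have -> : - (mass ls A - r * beta * \rsum_(u in l) mass ls (A :&: N u)) =
     - mass ls A + r * (\rsum_(u in l) (beta * Z u)) by rewrite -rsum_distr /Z; ring.
  rewrite exp_plus.
  have e0 := exp_pos (- mass ls A).
  have : \rsum_(u in l) exp (Z u) <= INR #|l| + \rsum_(u in l) (beta * Z u).
    rewrite -(Rmult_1_r (INR _)) -rsum_set_const -rsum_add; apply: rsum_le => u /tm[z4 zz].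
    by have := exp_le_quadratic z4; rewrite -/(Z u) in zz *; lra.
  set X := bigop _ _ _; set Y := bigop _ _ _ => XY.
  have := exp_ineq1_le (r * Y).
  have : r * X <= r * (INR #|l| + Y) by exact: Rmult_le_compat_l.
  move=> h1 h2.
  have -> : (1 - r * INR #|l|) * exp (- mass ls A) + r * (exp (- mass ls A) * X)
    = exp (- mass ls A) * (1 - r * INR #|l| + r * X) by ring.
  apply: Rmult_le_compat_l; first by lra.
  by rewrite Rmult_plus_distr_l in h1; lra.
have h1 : (1 - r * INR #|l|) * Ex r ls (fun S => exp (- (lam * INR #|A :\: nbr N S|)))
  <= (1 - r * INR #|l|) * (exp (- mass ls A) + defect b ls A).
  by apply: Rmult_le_compat_l => //; exact: Hb'.
have h2 : r * \rsum_(u in l) Ex r ls (fun S => exp (- (lam * INR #|A :\: nbr N (u |: S)|)))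
  <= r * (\rsum_(u in l) (exp (- mass ls A) * exp (mass ls (A :&: N u)))
      + \rsum_(u in l) defect b ls (A :\: N u)).
  by apply: Rmult_le_compat_l => //; rewrite -rsum_add; apply: rsum_le => u /Hn.
rewrite !Rmult_plus_distr_l in h1 h2; lra.
Qed.

End ExponentialTail.

(** * Expected hits, and two-sided tails when all classes are small *)

Section TailBounds.
Variables (T : finType) (N : T -> {set T}).
Hypothesis N_sym : forall u a, (u \in N a) = (a \in N u).
Implicit Types (ls : seq {set T}) (S A B C J : {set T}).

(** Multiplied by the rate, this is the expected number of picks that fall in [B]. *)
Definition mu ls B := \rsum_(l <- ls) INR #|l :&: B|.

Lemma mu_ge0 ls B : 0 <= mu ls B.
Proof. by apply: rsum_ge0 => l _; exact: pos_INR. Qed.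

Lemma mu_cons l ls B : mu (l :: ls) B = INR #|l :&: B| + mu ls B.
Proof. by rewrite /mu big_cons. Qed.

Lemma muUI ls A B : mu ls (A :|: B) + mu ls (A :&: B) = mu ls A + mu ls B.
Proof.
rewrite /mu -!rsum_add; apply: eq_bigr => l _; rewrite -!plus_INR; f_equal.
by rewrite setIUr setIIr plusE cardsUI.
Qed.

Lemma mu0 ls : mu ls set0 = 0.
Proof. by rewrite /mu big1 // => l _; rewrite setI0 cards0. Qed.

Lemma mu_nbr_inter ls A J k : 0 <= k ->
  (forall b, b \in J -> mu ls (A :&: N b) <= k) -> mu ls (A :&: nbr N J) <= INR #|J| * k.
Proof.
move=> k0; have [n] := ubnP #|J|; elim: n J => // n IH J Jn Hk.
have [->|[b bJ]] := set_0Vmem J; first by rewrite nbr0 setI0 mu0 cards0 /=; lra.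
rewrite -(setD1K bJ) nbrU1 setIUr cardsU1 setD11 add1n S_INR.
have := muUI ls (A :&: N b) (A :&: nbr N (J :\ b)).
have := mu_ge0 ls (A :&: N b :&: (A :&: nbr N (J :\ b))).
have : mu ls (A :&: nbr N (J :\ b)) <= INR #|J :\ b| * k.
  apply: IH; first by move: Jn; rewrite (cardsD1 b J) bJ; lia.
  by move=> c; rewrite inE => /andP[_ /Hk].
by have := Hk _ bJ; lra.
Qed.

(* Bonferroni: few common neighbours make the neighbourhoods almost disjoint. *)
Lemma mu_nbr_chain ls C (d k : R) j J : 0 <= k ->
  (forall a, a \in C -> d <= mu ls (N a)) ->
  (forall a b, a \in C -> b \in C -> a != b -> mu ls (N a :&: N b) <= k) ->
  J \in chains j C -> INR j * (d - INR j * k) <= mu ls (nbr N J).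
Proof.
move=> k0 Hd Hk.
suff H : J \in chains j C -> INR j * d - INR j * INR j * k <= mu ls (nbr N J).
  by move/H; lra.
elim: j J => [|j IH] J; first by rewrite inE => /eqP ->; rewrite nbr0 mu0 /=; lra.
move=> /allpairsPdep[J' [a [JC + ->]]]; rewrite mem_enum inE => /andP[aJ aC].
have [cJ sJ] := chainsP JC; have {IH} := IH _ JC.
rewrite nbrU1; have := muUI ls (N a) (nbr N J'); have := Hd _ aC.
have : mu ls (N a :&: nbr N J') <= INR #|J'| * k.
  apply: mu_nbr_inter => // b bJ'; apply: Hk => //; first exact: (subsetP sJ).
  by apply: contra aJ => /eqP ->.
rewrite cJ S_INR; have j0 := pos_INR j.
have : 0 <= INR j * k by exact: Rmult_le_pos.
by move=> *; nra.
Qed.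

Lemma INR_le1 (k : nat) : (k <= 1)%nat -> INR k = 0 \/ INR k = 1.
Proof. by case: k => [|[|k]] // _; [left | right]. Qed.

(** A line meets [N a] at most once, so every factor is 1 or 1 - h, and 1 - h lies between
    e^(-h(1+2h)) and e^(-h). *)
Lemma prod_bounds ls a h : 0 <= h <= / 2 -> (forall l, l \in ls -> (#|l :&: N a| <= 1)%nat) ->
  exp (- (h * (1 + 2 * h) * mu ls (N a))) <= \big[Rmult/1]_(l <- ls) (1 - h * INR #|l :&: N a|)
    <= exp (- (h * mu ls (N a))).
Proof.
move=> h2 l1.
have -> : - (h * (1 + 2 * h) * mu ls (N a)) = \rsum_(l <- ls) (- (h * (1 + 2 * h) * INR #|l :&: N a|)).
  have E c x : - (c * x) = (- c) * x by ring.
  by rewrite E rsum_distr; apply: eq_bigr => l _; ring.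
have -> : - (h * mu ls (N a)) = \rsum_(l <- ls) (- (h * INR #|l :&: N a|)).
  have E c x : - (c * x) = (- c) * x by ring.
  by rewrite E rsum_distr; apply: eq_bigr => l _; ring.
rewrite -!rprod_exp; split; rewrite big_seq_cond [X in _ <= X]big_seq_cond; apply: rprod_le => l; rewrite andbT => /l1/INR_le1[->|->].
- by rewrite !Rmult_0_r Ropp_0 exp_0; lra.
- by rewrite !Rmult_1_r; split; [exact/Rlt_le/exp_pos | exact: exp_sub_le_1m].
- by rewrite !Rmult_0_r Ropp_0 exp_0; lra.
- by rewrite !Rmult_1_r; split; [lra | exact: one_minus_le_exp].
Qed.

Lemma prod_01 ls a h : 0 <= h <= / 2 -> (forall l, l \in ls -> (#|l :&: N a| <= 1)%nat) ->
  0 <= \big[Rmult/1]_(l <- ls) (1 - h * INR #|l :&: N a|) <= 1.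
Proof.
move=> h2 l1; have [lo hi] := prod_bounds h2 l1.
split; first by apply: Rle_trans lo; exact/Rlt_le/exp_pos.
apply: Rle_trans hi _; rewrite -exp_0; apply: exp_le.
have : 0 <= h * mu ls (N a) by apply: Rmult_le_pos; [lra | exact: mu_ge0].
lra.
Qed.

Lemma defect0 r (ls : seq {set T}) A : defect N r (fun _ _ _ => 0) ls A = 0.
Proof.
elim: ls A => //= l ls IH A; rewrite IH.
by rewrite big1 // big1 => [|u _]; [ring | exact: IH].
Qed.

Lemma mass_ge ls A r lam beta d : 0 <= lam -> 0 <= r * beta <= / 2 ->
  (forall a l, a \in A -> l \in ls -> (#|l :&: N a| <= 1)%nat) ->
  (forall a, a \in A -> mu ls (N a) <= d) ->
  lam * INR #|A| * exp (- (r * beta * (1 + 2 * (r * beta)) * d)) <= mass N r lam beta ls A.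
Proof.
move=> lam0 h2 l1 Hd; rewrite (Rmult_comm lam) Rmult_assoc -rsum_set_const.
apply: rsum_le => a aA; apply: Rmult_le_compat_l => //.
have [lo _] := prod_bounds h2 (fun l => l1 a l aA); apply: Rle_trans lo.
apply/exp_le/Ropp_le_contravar/Rmult_le_compat_l; last exact: Hd.
by apply: Rmult_le_pos; lra.
Qed.

Section BoundedClasses.
Variables (r eta kappa : R) (ls : seq {set T}) (A : {set T}).
Hypotheses (adm : admissible r ls) (eta4 : 0 <= eta <= / 4) (kappa0 : 0 < kappa)
  (r4 : r <= / 4)
  (kills1 : forall a l, a \in A -> l \in ls -> (#|l :&: N a| <= 1)%nat)
  (class_le : forall l u, l \in ls -> u \in l -> INR #|A :&: N u| <= kappa).

Lemma class_mass_le beta A' ls' l u : 0 <= beta <= 2 ->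
  A' \subset A -> {subset ls' <= ls} -> l \in ls -> u \in l ->
  0 <= mass N r 1 beta ls' (A' :&: N u) <= kappa.
Proof.
move=> b2 A'A sls lls ul.
have h2 : 0 <= r * beta <= / 2 by case: adm => r0 _; split; nra.
have w01 a : a \in A' :&: N u -> 0 <= wt N r 1 beta ls' a <= 1.
  rewrite inE => /andP[/(subsetP A'A) aA _]; rewrite /wt Rmult_1_l.
  by apply: prod_01 => // k /sls; exact: kills1.
split; first by apply: rsum_ge0 => a /w01[].
apply: (Rle_trans _ (\rsum_(a in A' :&: N u) 1)); first by apply: rsum_le => a /w01[].
rewrite rsum_set_const Rmult_1_r; apply: Rle_trans (class_le lls ul).
exact/le_INR/leP/subset_leq_card/setSI.
Qed.

Lemma mass_lam lam beta ls' A' : mass N r lam beta ls' A' = lam * mass N r 1 beta ls' A'.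
Proof. by rewrite /mass rsum_distr; apply: eq_bigr => a _; rewrite /wt; ring. Qed.

Lemma lower_tail d : (forall a, a \in A -> mu ls (N a) <= d) ->
  Ex r ls (fun S => exp (- (eta / kappa * INR #|A :\: nbr N S|)))
   <= exp (- (eta / kappa * INR #|A| * exp (- (r * (1 + eta) * (1 + 2 * (r * (1 + eta))) * d)))).
Proof.
move=> Hd; have [r0 _] := adm.
have lam0 : 0 <= eta / kappa by apply: Rmult_le_pos; [lra | exact/Rlt_le/Rinv_0_lt_compat].
have lk : eta / kappa * kappa = eta by field; lra.
set lam := eta / kappa in lam0 lk *.
apply: Rle_trans.
  apply: (@exponential_tail _ _ N_sym r lam (1 + eta) (fun _ _ _ => 0) ls A adm).
  move=> A' ls' l u A'A sls lls ul; split; first by lra.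
  left; have [Z0 Zk] := class_mass_le (beta := 1 + eta) ltac:(lra) A'A sls lls ul.
  rewrite mass_lam; set Z := mass _ _ _ _ _ _ in Z0 Zk *.
  have : 0 <= lam * Z by exact: Rmult_le_pos.
  have : lam * Z <= lam * kappa by exact: Rmult_le_compat_l.
  by split; nra.
rewrite defect0 Rplus_0_r; apply/exp_le/Ropp_le_contravar.
by apply: mass_ge => //; split; nra.
Qed.

(** The same argument with [- lam] and [beta = 1 - eta]: the class masses now lie between [- eta]
    and 0. *)
Lemma upper_tail d : (forall a, a \in A -> d <= mu ls (N a)) ->
  Ex r ls (fun S => exp (eta / kappa * INR #|A :\: nbr N S|))
   <= exp (eta / kappa * INR #|A| * exp (- (r * (1 - eta) * d))).
Proof.
move=> Hd; have [r0 _] := adm.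
have lam0 : 0 <= eta / kappa by apply: Rmult_le_pos; [lra | exact/Rlt_le/Rinv_0_lt_compat].
have lk : eta / kappa * kappa = eta by field; lra.
set lam := eta / kappa in lam0 lk *.
have h2 : 0 <= r * (1 - eta) <= / 2 by split; nra.
have := @exponential_tail _ _ N_sym r (- lam) (1 - eta) (fun _ _ _ => 0) ls A adm.
rewrite defect0 Rplus_0_r => H; apply: Rle_trans (Rle_trans _ _ _ (H _) _).
- by apply: Req_le; apply: Ex_ext => S; congr exp; ring.
- move=> A' ls' l u A'A sls lls ul; split; first by lra.
  left; have [Z0 Zk] := class_mass_le (beta := 1 - eta) ltac:(lra) A'A sls lls ul.
  rewrite mass_lam; set Z := mass _ _ _ _ _ _ in Z0 Zk *.
  have : 0 <= lam * Z by exact: Rmult_le_pos.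
  have : lam * Z <= lam * kappa by exact: Rmult_le_compat_l.
  by split; nra.
rewrite mass_lam -Ropp_mult_distr_l Ropp_involutive Rmult_assoc; apply: exp_le.
apply: Rmult_le_compat_l => //; rewrite -rsum_set_const; apply: rsum_le => a aA.
rewrite /wt Rmult_1_l; have [_ hi] := prod_bounds h2 (fun l => kills1 (a := a) (l := l) aA).
apply: Rle_trans hi _; apply/exp_le/Ropp_le_contravar/Rmult_le_compat_l; first by lra.
exact: Hd.
Qed.

End BoundedClasses.
End TailBounds.

(** * Lower tail when classes are heavy: a moment of order j *)

Section MomentTail.
Variables (T : finType) (N : T -> {set T}).
Hypothesis N_sym : forall u a, (u \in N a) = (a \in N u).
Variables (r lam eta kappa : R) (j : nat) (ls : seq {set T}) (A : {set T}).
Implicit Types (S C J l : {set T}).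
Hypotheses (adm : admissible r ls) (lam0 : 0 <= lam) (eta4 : 0 <= eta <= / 4)
  (r4 : r <= / 4) (lam_eta : 0 < eta - INR j * lam)
  (kills1 : forall a l, a \in A -> l \in ls -> (#|l :&: N a| <= 1)%nat)
  (class_le : forall l u, l \in ls -> u \in l -> INR #|A :&: N u| <= kappa).

Let beta := 1 + eta.
Let x := eta - INR j * lam.

(** Markov bound of order [j]: by [chains_sum_ge] it is at least 1 once the mass of the class of [u]
    exceeds [eta], so it can serve as the penalty of [exponential_tail]. *)
Definition class_excess (A' : {set T}) (ls' : seq {set T}) (u : T) : R :=
  / x ^ j * \rsum_(J <- chains j (A :&: N u))
    (ind (J \subset A') * \big[Rmult/1]_(a in J) wt N r lam beta ls' a).

Definition class_chains (l : {set T}) : seq {set T} :=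
  flatten [seq chains j (A :&: N u) | u <- enum l].

Lemma class_chainsP l J : J \in class_chains l ->
  [/\ #|J| = j, J \subset A & exists2 u, u \in l & J \in chains j (A :&: N u)].
Proof.
case/flattenP=> s /mapP[u]; rewrite mem_enum => ul -> JC.
have [cJ sJ] := chainsP JC; split=> //; last by exists u.
exact: subset_trans sJ (subsetIl _ _).
Qed.

Lemma rbeta2 : 0 <= r * beta <= / 2.
Proof. by case: adm => r0 _; rewrite /beta; split; nra. Qed.

Lemma xj_gt0 : 0 < / x ^ j.
Proof. exact/Rinv_0_lt_compat/pow_lt. Qed.

Lemma card_inter_nbr_le l J : l \in ls -> J \subset A -> INR #|l :&: nbr N J| <= INR #|J|.
Proof.
move=> lls JA.
have := @mu_nbr_inter _ N [:: l] setT J 1; rewrite setTI Rmult_1_r /mu big_seq1.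
apply; first by lra.
move=> b /(subsetP JA) bA; rewrite big_seq1 setTI.
by apply: (le_INR _ 1); have := kills1 bA lls; lia.
Qed.

(** Since [mu] is subadditive, the product of the separate weights is dominated by the bound for
    joint survival of [J]. Only [beta >= 1] is used for the exponent. *)
Lemma prod_wt_le ls' J : {subset ls' <= ls} -> J \subset A ->
  0 <= \big[Rmult/1]_(a in J) wt N r lam beta ls' a
    <= lam ^ #|J| * exp (- (r * mu ls' (nbr N J))).
Proof.
move=> sls; have [n] := ubnP #|J|; elim: n J => // n IH J Jn JA.
have [->|[b bJ]] := set_0Vmem J.
  by rewrite big_set0 cards0 nbr0 mu0 Rmult_0_r Ropp_0 exp_0 /=; lra.
have bA := subsetP JA _ bJ.
rewrite (big_setD1 b) //= -{3 4}(setD1K bJ) nbrU1 cardsU1 setD11 add1n.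
have [||P0 P1] := IH (J :\ b).
- by move: Jn; rewrite (cardsD1 b J) bJ; lia.
- exact: subset_trans (subsetDl _ _) JA.
have k1 l : l \in ls' -> (#|l :&: N b| <= 1)%nat by move=> /sls; exact: kills1.
have [q0 _] := prod_01 rbeta2 k1; have [_ q1] := prod_bounds rbeta2 k1.
have w0 : 0 <= wt N r lam beta ls' b by exact: Rmult_le_pos.
split; first exact: Rmult_le_pos.
apply: (Rle_trans _ ((lam * exp (- (r * mu ls' (N b)))) *
    (lam ^ #|J :\ b| * exp (- (r * mu ls' (nbr N (J :\ b))))))).
  apply: Rmult_le_compat => //; apply: Rmult_le_compat_l => //.
  apply: Rle_trans q1 _; apply/exp_le/Ropp_le_contravar/Rmult_le_compat_r; first exact: mu_ge0.
  by case: adm => r0 _; rewrite /beta; nra.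
have -> : forall a b c d : R, (a * b) * (c * d) = (a * c) * (b * d) by move=> *; ring.
rewrite -exp_plus; apply: Rmult_le_compat_l.
  by apply: Rmult_le_pos => //; exact: pow_le.
apply: exp_le.
have := muUI ls' (N b) (nbr N (J :\ b)); have := mu_ge0 ls' (N b :&: nbr N (J :\ b)).
case: adm => r0 _ *; nra.
Qed.

(** For a set [J] arising at a line [l], survival over the lines before [l] and the weights over the
    lines after it combine to exp(-r mu) over all lines but [l], wherever [l] stands in the order.
    The missing line meets [nbr N J] in at most [j] points, whence the factor [exp (r * INR j)]. *)
Lemma defect_le_chains ls' A' : {subset ls' <= ls} ->
  defect N r class_excess ls' A' <= / x ^ j * exp (r * INR j) * lam ^ j *
    \rsum_(J <- flatten [seq class_chains l | l <- ls'])
       (ind (J \subset A') * exp (- (r * mu ls' (nbr N J)))).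
Proof.
have [r0 radm] := adm.
have c0 : 0 <= / x ^ j * exp (r * INR j) * lam ^ j.
  apply: Rmult_le_pos; last exact: pow_le.
  by apply: Rmult_le_pos; [exact/Rlt_le/xj_gt0 | exact/Rlt_le/exp_pos].
elim: ls' A' => [|l ls' IH] A' sls /=; first by rewrite big_nil; lra.
have sls' : {subset ls' <= ls} by move=> k kl; apply: sls; rewrite inE kl orbT.
have lls : l \in ls by apply: sls; exact: mem_head.
have r1 : 0 <= 1 - r * INR #|l| by have := radm _ lls; lra.
rewrite big_cat /= Rmult_plus_distr_l; apply: Rplus_le_compat.
  rewrite -rsum_distr big_flatten big_map big_enum /= !Rmult_assoc; apply: Rmult_le_compat_l.
    exact/Rlt_le/xj_gt0.
  rewrite -Rmult_assoc rsum_distr; apply: rsum_le => u ul.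
  rewrite rsum_distr big_seq_cond [X in _ <= X]big_seq_cond.
  apply: rsum_le => J; rewrite andbT => JC.
  have [cJ sJ] := chainsP JC.
  have JA : J \subset A by exact: subset_trans sJ (subsetIl _ _).
  have [_ wl] := prod_wt_le sls' JA; rewrite cJ in wl.
  have := card_inter_nbr_le lls JA; rewrite cJ mu_cons => cl.
  set I := INR #|l :&: _| in cl *; set m := mu _ _ in wl *.
  have -> : exp (r * INR j) * lam ^ j * (ind (J \subset A') * exp (- (r * (I + m))))
     = ind (J \subset A') * (lam ^ j * (exp (r * INR j) * exp (- (r * (I + m))))) by ring.
  apply: Rmult_le_compat_l; first exact: ind_ge0.
  apply: Rle_trans wl _; apply: Rmult_le_compat_l; first exact: pow_le.
  by rewrite -exp_plus; apply: exp_le; nra.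
set Q := flatten _; set c := _ * lam ^ j in c0 IH *.
have h1 : (1 - r * INR #|l|) * defect N r class_excess ls' A' <= (1 - r * INR #|l|) *
  (c * \rsum_(J <- Q) (ind (J \subset A') * exp (- (r * mu ls' (nbr N J))))).
  by apply: Rmult_le_compat_l => //; exact: IH.
have h2 : r * \rsum_(u in l) defect N r class_excess ls' (A' :\: N u) <= r * \rsum_(u in l)
  (c * \rsum_(J <- Q) (ind (J \subset A' :\: N u) * exp (- (r * mu ls' (nbr N J))))).
  by apply: Rmult_le_compat_l => //; apply: rsum_le => u _; exact: IH.
apply: Rle_trans (Rplus_le_compat _ _ _ _ h1 h2) _.
rewrite -rsum_distr exchange_big /=.
have -> : forall p q X Y, p * (c * X) + q * (c * Y) = c * (p * X + q * Y) by move=> *; ring.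
apply: Rmult_le_compat_l => //.
rewrite !rsum_distr -rsum_add; apply: rsum_le => J _.
rewrite -rsum_distl.
have -> : \rsum_(u in l) ind (J \subset A' :\: N u) = ind (J \subset A') * (INR #|l| - INR #|l :&: nbr N J|).
  rewrite (eq_bigr (fun u => ind (J \subset A') * ind (u \in ~: nbr N J))); last first.
    by move=> u _; rewrite subsetD indM disjoint_nbr // inE.
  rewrite -rsum_distr rsum_ind_card -setDE; congr (_ * _).
  by rewrite -(cardsID (nbr N J) l) plus_INR; ring.
rewrite mu_cons; set I := INR #|l :&: _|; set m := mu _ _.
have -> : - (r * (I + m)) = - (r * I) + - (r * m) by ring.
rewrite exp_plus.
have -> : (1 - r * INR #|l|) * (ind (J \subset A') * exp (- (r * m))) +
  r * (ind (J \subset A') * (INR #|l| - I) * exp (- (r * m))) =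
  ind (J \subset A') * (exp (- (r * m)) * (1 - r * I)) by ring.
apply: Rmult_le_compat_l; first exact: ind_ge0.
rewrite Rmult_comm; apply: Rmult_le_compat_r; first exact/Rlt_le/exp_pos.
exact: one_minus_le_exp.
Qed.

Lemma size_class_chains : INR (size (flatten [seq class_chains l | l <- ls])) <= mu ls setT * kappa ^ j.
Proof.
have : {subset ls <= ls} by [].
elim: {1 3 4}ls => [|l ls' IH] sls /=; first by rewrite /mu big_nil /=; lra.
rewrite size_cat plus_INR mu_cons setIT Rmult_plus_distr_r; apply: Rplus_le_compat; last first.
  by apply: IH => k kl; apply: sls; rewrite inE kl orbT.
rewrite size_flatten /shape sumnE !big_map big_enum /= INR_sum -rsum_set_const.
apply: rsum_le => u ul; apply: Rle_trans (size_chains _ _) _.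
by apply: pow_incr; split; [exact: pos_INR | apply: (class_le (l := l)) => //; apply: sls; exact: mem_head].
Qed.

(* Classes too heavy for [exponential_tail] are excluded by a [j]-th moment computation. *)
Lemma lower_tail_moment d m :
  (forall a, a \in A -> mu ls (N a) <= d) ->
  (forall l u J, l \in ls -> u \in l -> J \in chains j (A :&: N u) -> m <= mu ls (nbr N J)) ->
  Ex r ls (fun S => exp (- (lam * INR #|A :\: nbr N S|)))
   <= exp (- (lam * INR #|A| * exp (- (r * (1 + eta) * (1 + 2 * (r * (1 + eta))) * d))))
      + mu ls setT * (kappa * lam / (eta - INR j * lam)) ^ j * exp (r * INR j - r * m).
Proof.
move=> Hd Hm; have [r0 _] := adm.
apply: Rle_trans.
  apply: (@exponential_tail _ _ N_sym r lam beta class_excess ls A adm).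
  move=> A' ls' l u A'A sls lls ul.
  have w_le a : a \in A :&: N u -> 0 <= wt N r lam beta ls' a <= lam.
    rewrite inE => /andP[aA _].
    have k1 k : k \in ls' -> (#|k :&: N a| <= 1)%nat by move=> /sls; exact: kills1.
    have := prod_01 rbeta2 k1; rewrite /wt; nra.
  split.
    apply: Rmult_le_pos; first exact/Rlt_le/xj_gt0.
    rewrite big_seq_cond; apply: rsum_ge0 => J; rewrite andbT => /chainsP[_ JC].
    apply: Rmult_le_pos; first exact: ind_ge0.
    by apply: rprod_ge0 => a /(subsetP JC)/w_le[].
  have AN : A' :&: N u = A :&: N u :&: A'.
    by apply/setP => a; rewrite !inE; case: (boolP (a \in A')) => [/(subsetP A'A) ->|_]; rewrite ?andbT ?andbF.
  case: (Rle_dec (mass N r lam beta ls' (A' :&: N u)) eta) => Z; [left|right].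
    have Z0 : 0 <= mass N r lam beta ls' (A' :&: N u).
      by apply: rsum_ge0 => a; rewrite AN inE => /andP[/w_le[]].
    split; first by lra.
    by have -> : beta - 1 = eta by [rewrite /beta; ring]; exact: Rmult_le_compat_r.
  split=> //.
  have := @chains_sum_ge _ (wt N r lam beta ls') lam eta j (A :&: N u) A' lam0 w_le.
  rewrite -AN => H; have {}H := H ltac:(lra) ltac:(rewrite /mass in Z; lra).
  rewrite /class_excess; apply: (Rmult_le_reg_l (x ^ j)); first exact: pow_lt.
  by rewrite -Rmult_assoc Rinv_r ?Rmult_1_l ?Rmult_1_r //; have := pow_lt _ j lam_eta; rewrite -/x; lra.
apply: Rplus_le_compat.
  by apply/exp_le/Ropp_le_contravar/mass_ge => //; exact: rbeta2.
apply: Rle_trans (defect_le_chains _ (fun _ h => h)) _.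
have lj := pow_le _ j lam0; have xj := xj_gt0.
apply: (Rle_trans _ (/ x ^ j * exp (r * INR j) * lam ^ j * ((mu ls setT * kappa ^ j) * exp (- (r * m))))).
  apply: Rmult_le_compat_l.
    by apply: Rmult_le_pos => //; apply: Rmult_le_pos; [lra | exact/Rlt_le/exp_pos].
  apply: (Rle_trans _ (\rsum_(J <- flatten [seq class_chains l | l <- ls]) exp (- (r * m)))); last first.
    rewrite rsum_const count_predT; apply: Rmult_le_compat_r; first exact/Rlt_le/exp_pos.
    exact: size_class_chains.
  rewrite big_seq_cond [X in _ <= X]big_seq_cond; apply: rsum_le => J; rewrite andbT.
  case/flattenP=> _ /mapP[l lls ->] /class_chainsP[_ _ [u ul JC]].
  rewrite -[X in _ <= X]Rmult_1_l; apply: Rmult_le_compat; [exact: ind_ge0 | exact/Rlt_le/exp_pos | exact: ind_le1|].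
  by apply/exp_le/Ropp_le_contravar/Rmult_le_compat_l => //; exact: (Hm l u).
apply: Req_le; rewrite /Rdiv !Rpow_mult_distr pow_inv -/x /Rminus exp_plus; ring.
Qed.

End MomentTail.

(** * Generalized quadrangles *)

Section Geometry.
Variables (Pt Ln : finType) (I : Pt -> Ln -> bool) (s t : nat).
Hypothesis gq : is_GQ I s t.
Implicit Types (a b c x y z u v w : Pt) (l m : Ln) (A B C D : {set Pt}).

Definition perp a := [set u | collinear I u a].

Lemma collinear_sym : symmetric (collinear I).
Proof. by move=> a b; apply: eq_existsb => l; rewrite andbC. Qed.

Lemma perp_sym u a : (u \in perp a) = (a \in perp u).
Proof. by rewrite !inE collinear_sym. Qed.

Lemma collinearP a b l : I a l -> I b l -> collinear I a b.
Proof. by move=> al bl; apply/existsP; exists l; rewrite al bl. Qed.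

Lemma exists_line a : exists l, I a l.
Proof.
case: gq => _ /(_ a) H _ _ _.
have : (0 < #|[set l | I a l]|)%nat by rewrite H.
by case/card_gt0P=> l; rewrite inE; exists l.
Qed.

Lemma collinear_refl a : collinear I a a.
Proof. by have [l al] := exists_line a; exact: (collinearP al al). Qed.

Lemma line_uniq a b l m : a != b -> I a l -> I b l -> I a m -> I b m -> l = m.
Proof.
case: gq => _ _ _ H _ ab al bl am bm; apply/eqP; apply/negPn; apply/negP => lm.
have := H a b ab; apply/negP.
rewrite -ltnNge; have -> : 2%nat = #|[set l; m]| by rewrite cards2 lm.
by apply: subset_leq_card; apply/subsetP => k; rewrite !inE => /orP[] /eqP ->; apply/andP.
Qed.

Lemma trace_uniq a l u v : ~~ I a l -> I u l -> I v l -> collinear I u a -> collinear I v a -> u = v.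
Proof.
case: gq => _ _ _ _ H /H[[p m] [_ U]] ul vl /existsP[k /andP[uk ak]] /existsP[k' /andP[vk' ak']].
have [<- _] : (p, m) = (u, k) by apply: U; rewrite /= ul ak uk.
by have [<- _] : (p, m) = (v, k') by apply: U; rewrite /= vl ak' vk'.
Qed.

Lemma trace_exists a l : exists2 u, I u l & collinear I u a.
Proof.
case al: (I a l); first by exists a; rewrite ?collinear_refl.
case: gq => _ _ _ _ /(_ a l); rewrite al => /(_ isT)[[p m] [/= /and3P[pl am pm] _]].
by exists p => //; exact: collinearP pm am.
Qed.

Lemma no_triangle x u v l m : l != m -> I x l -> I x m -> I u l -> I v m -> u != x -> v != x ->
  ~~ collinear I u v.
Proof.
move=> lm xl xm ul vm ux vx; apply/negP => uv.
have um : ~~ I u m.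
  by apply: contra lm => um; apply/eqP; exact: (line_uniq ux).
suff /eqP : v = x by rewrite (negbTE vx).
apply: (trace_uniq um) => //; first by rewrite collinear_sym.
exact: collinearP xl ul.
Qed.

(** The centre is left out, since it is collinear with every point of these lines. *)
Definition pencil x : seq {set Pt} :=
  [seq [set u | I u l & u != x] | l <- enum [set l | I x l]].

Lemma pencilP x (k : {set Pt}) :
  reflect (exists2 l, I x l & k = [set u | I u l & u != x]) (k \in pencil x).
Proof.
apply: (iffP mapP) => -[l]; first by rewrite mem_enum inE => xl ->; exists l.
by move=> xl ->; exists l; rewrite // mem_enum inE.
Qed.

Lemma size_pencil x : size (pencil x) = t.+1.
Proof. by rewrite size_map -cardE; case: gq. Qed.

Lemma pencil_pairwise x B :
  pairwise (fun k k' : {set Pt} => [forall u in k, forall v in k', ~~ collinear I u v])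
    (restrict (pencil x) B).
Proof.
rewrite /restrict /pencil -map_comp pairwise_map.
have := enum_uniq [set l | I x l]; rewrite uniq_pairwise => pw.
apply: (sub_in_pairwise (P := mem [set l | I x l])) pw; last first.
  by apply/allP => l; rewrite mem_enum.
move=> l m; rewrite !inE => xl xm /= lm.
apply/forall_inP => u; rewrite !inE => /andP[/andP[ul ux] _].
apply/forall_inP => v; rewrite !inE => /andP[/andP[vm vx] _].
exact: no_triangle lm xl xm ul vm ux vx.
Qed.

(** This is the hypothesis [kills1] of the tail bounds, and the reason why they only concern points
    off [perp x]. *)
Lemma pencil_card1 x a B (k : {set Pt}) : a \notin perp x -> k \in restrict (pencil x) B ->
  (#|k :&: perp a| <= 1)%nat.
Proof.
rewrite inE => ax /mapP[k' /pencilP[l xl ->] ->].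
apply/card_le1_eqP => u v; rewrite !inE => /andP[/andP[/andP[ul _] _] ua] /andP[/andP[/andP[vl _] _] va].
apply: (trace_uniq (a := a) (l := l)) => //.
by apply: contra ax => al; exact: collinearP al xl.
Qed.

(** The lines through [x] partition the points other than [x] collinear with it. *)
Lemma sum_pencil x D :
  (\sum_(l in [set l | I x l]) #|[set u | I u l & u != x] :&: D| = #|(perp x :\ x) :&: D|)%nat.
Proof.
rewrite (eq_bigr (fun l => \sum_(u in D | u != x) (I u l : nat))%nat); last first.
  move=> l _; rewrite -sum1_card [RHS]big_mkcond [LHS]big_mkcond; apply: eq_bigr => u _.
  by rewrite !inE; case: (I u l); case: (u \in D); case: (u != x).
rewrite exchange_big /= -sum1_card [RHS]big_mkcond [LHS]big_mkcond; apply: eq_bigr => u _.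
rewrite !inE; case ux: (u != x); rewrite /= ?andbF //; case uD: (u \in D); rewrite ?andbF ?andbT //=.
rewrite -big_mkcondr /= sum1dep_card.
case: ifP => [/existsP[l /andP[ul xl]]|].
  apply/eqP; rewrite -(cards1 l); apply/eqP; congr #|pred_of_set _|.
  apply/setP => m; rewrite !inE; apply/andP/eqP => [[xm um]|-> //].
  exact: (line_uniq ux).
move=> /negbT H; apply/eqP; rewrite cards_eq0; apply/eqP/setP => m; rewrite !inE.
by apply: contraNF H => /andP[xm um]; exact: collinearP um xm.
Qed.

Lemma mu_pencil x B C : mu (restrict (pencil x) B) C = INR #|(perp x :\ x) :&: B :&: C|.
Proof.
rewrite -setIA -sum_pencil INR_sum /mu !big_map big_enum.
by apply: eq_bigr => l _; rewrite setIA.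
Qed.

Lemma card_line_minus x l : I x l -> #|[set u | I u l & u != x]| = s.
Proof.
move=> xl; case: gq => _ _ /(_ l) + _ _.
rewrite (cardsD1 x) inE xl => -[<-]; congr #|pred_of_set _|.
by apply/setP => u; rewrite !inE andbC.
Qed.

Lemma card_perpD1 x : #|perp x :\ x| = (s * t.+1)%nat.
Proof.
rewrite -[perp x :\ x]setIT -sum_pencil (eq_bigr (fun=> s)); last first.
  by move=> l; rewrite inE setIT; exact: card_line_minus.
by rewrite sum_nat_const mulnC; case: gq => _ ->.
Qed.

Lemma card_perp x : #|perp x| = (s * t.+1).+1.
Proof. by rewrite (cardsD1 x) inE collinear_refl card_perpD1. Qed.

Lemma card_common a x : a \notin perp x -> #|perp x :&: perp a| = t.+1.
Proof.
move=> ax; have <- : #|(perp x :\ x) :&: perp a| = #|perp x :&: perp a|.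
  congr #|pred_of_set _|; apply/setP => u; rewrite !inE.
  by case: (altP (u =P x)) => //= ->; move: ax; rewrite inE collinear_sym andbC => /negbTE ->.
rewrite -sum_pencil (eq_bigr (fun=> 1%nat)); first by rewrite sum1_card; case: gq.
move=> l; rewrite inE => xl; apply/eqP; rewrite eqn_leq; apply/andP; split.
  have := @pencil_card1 x a setT [set u | I u l & u != x] ax; apply.
  by apply/mapP; exists [set u | I u l & u != x]; rewrite ?setIT //; apply/pencilP; exists l.
apply/card_gt0P; have [u ul ua] := trace_exists a l; exists u; rewrite !inE ul ua andbT /=.
by apply: contra ax => /eqP <-; rewrite inE collinear_sym.
Qed.

Lemma pencil_line_card_le x B k : k \in restrict (pencil x) B -> (#|k| <= s)%nat.
Proof.
case/mapP=> k' /pencilP[l xl ->] ->; rewrite -(card_line_minus xl).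
exact/subset_leq_card/subsetIl.
Qed.

Lemma pencil_admissible x B r : 0 <= r -> r * INR s <= 1 -> admissible r (restrict (pencil x) B).
Proof.
move=> r0 rs; split=> // k /pencil_line_card_le ks; apply: Rle_trans rs.
by apply: Rmult_le_compat_l => //; apply/le_INR/leP.
Qed.

(** Every point is collinear with some point of a fixed line. The overcount is harmless, as only a
    polynomial bound in s is wanted. *)
Lemma card_points x : (#|Pt| <= s.+1 * (s * t.+1).+1)%nat.
Proof.
have [l xl] := exists_line x.
have cl : #|[set u | I u l]| = s.+1 by case: gq.
rewrite -cl -sum_nat_const -[X in (X <= _)%nat]cardsT.
apply: (@leq_trans #|\bigcup_(u in [set u | I u l]) perp u|).
  apply/subset_leq_card/subsetP => a _.
  have [u ul ua] := trace_exists a l.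
  by apply/bigcupP; exists u; rewrite inE // collinear_sym.
apply: (@leq_trans (\sum_(u in [set u | I u l]) #|perp u|)%nat).
  elim/big_ind2: _ => // [|A1 n1 A2 n2 h1 h2]; first by rewrite cards0.
  by apply: leq_trans (leq_card_setU _ _) (leq_add h1 h2).
by apply: leq_sum => u _; rewrite card_perp.
Qed.

Lemma three_noncollinear u : exists x y z,
  [/\ x \notin perp y, x \notin perp z & y \notin perp z].
Proof.
case: (gq) => /andP[s2 t2] /(_ u) H _ _ _.
have [l1 [l2 [l3 [[u1 u2 u3] [n12 n13 n23]]]]] : exists l1 l2 l3, [/\ I u l1, I u l2 & I u l3] /\
   [/\ l1 != l2, l1 != l3 & l2 != l3].
  have : (2 < #|[set l | I u l]|)%nat by rewrite H; lia.
  case/card_gt2P=> l1 [l2 [l3 [[]]]]; rewrite !inE => a b c [d e f].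
  by exists l1, l2, l3; split=> //; split=> //; rewrite eq_sym.
have pick l : I u l -> exists2 x, I x l & x != u.
  move=> ul; have : (0 < #|[set x | I x l & x != u]|)%nat by rewrite card_line_minus //; lia.
  by case/card_gt0P=> x; rewrite inE => /andP[]; exists x.
have [x xl xu] := pick _ u1; have [y yl yu] := pick _ u2; have [z zl zu] := pick _ u3.
exists x, y, z; rewrite !inE; split.
- exact: no_triangle n12 u1 u2 xl yl xu yu.
- exact: no_triangle n13 u1 u3 xl zl xu zu.
- exact: no_triangle n23 u2 u3 yl zl yu zu.
Qed.

(** * Consequences of local sparsity *)

Hypothesis sparse : locally_sparse I s.

Lemma card_triple a b c : a != b -> a != c -> b != c ->
  (#|perp a :&: perp b :&: perp c| <= s.+1)%nat.
Proof.
move=> ab ac bc; apply: leq_trans (sparse ab ac bc); apply: subset_leq_card.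
by apply/subsetP => z; rewrite !inE => /andP[/andP[-> ->] ->].
Qed.

Lemma notin_perp_neq a b : a \notin perp b -> a != b.
Proof. by apply: contra => /eqP ->; rewrite inE collinear_refl. Qed.

(* Count pairs (w', z) with w' in {x,y}^perp and z in {w,w'}^perp, for a fixed w in {x,y}^perp. *)
Lemma order_le x y : x \notin perp y -> (t <= 2 * (s * s))%nat.
Proof.
move=> xy; have [/andP[s2 t2] _ _ _ _] := gq.
have cxy : #|perp y :&: perp x| = t.+1 by exact: card_common.
have [w wxy] : exists w, w \in perp y :&: perp x by apply/card_gt0P; rewrite cxy.
set E := (perp y :&: perp x) :\ w.
have cE : #|E| = t by have := cardsD1 w (perp y :&: perp x); rewrite cxy wxy => -[].
(* Removing x and y keeps x, y, z distinct, so that sparsity applies; it costs two of the t+1 common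
   neighbours of w and w', whence [t.-1]. *)
pose Z := perp w :\: [set x; y].
have low w' : w' \in E -> (t.-1 <= #|Z :&: perp w'|)%nat.
  rewrite !inE => /andP[w'w /andP[w'y w'x]].
  move: wxy; rewrite !inE => /andP[wy wx].
  have ww' : w' \notin perp w.
    rewrite inE; apply/negP => /existsP[l /andP[w'l wl]].
    have w'Nx : w' != x by apply: contra xy => /eqP <-; rewrite inE.
    have wNx : w != x by apply: contra xy => /eqP <-; rewrite inE.
    have w'Ny : w' != y by apply: contra xy => /eqP <-; rewrite inE collinear_sym.
    have wNy : w != y by apply: contra xy => /eqP <-; rewrite inE collinear_sym.
    (* A point collinear with two points of a line lies on it; if w and w' were collinear, their
       line would contain both x and y. *)
    have onl p : collinear I w' p -> collinear I w p -> I p l.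
      move=> w'p wp; case pl: (I p l) => //; move: w'w.
      by rewrite (trace_uniq (negbT pl) w'l wl w'p wp) eqxx.
    have xl := onl _ w'x wx; have yl := onl _ w'y wy.
    by move: xy; rewrite inE (collinearP xl yl).
  have := card_common ww'; rewrite -(cardsID [set x; y] (perp w :&: perp w')) setIDAC => c1.
  have : (#|perp w :&: perp w' :&: [set x; y]| <= 2)%nat.
    apply: leq_trans (subset_leq_card (subsetIr _ _)) _.
    by rewrite cards2; case: (_ != _).
  by rewrite /Z; lia.
have up z : z \in Z -> (#|[set w' in E | z \in perp w']| <= s.+1)%nat.
  rewrite !inE negb_or => /andP[/andP[zx zy] _].
  have xNy : x != y by exact: notin_perp_neq.
  apply: leq_trans (card_triple xNy _ _); [|by rewrite eq_sym; exact: zx|by rewrite eq_sym; exact: zy].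
  apply/subset_leq_card/subsetP => w'; rewrite !inE => /andP[/andP[_ /andP[-> ->]]].
  by rewrite collinear_sym.
have dc : (\sum_(w' in E) #|Z :&: perp w'| = \sum_(z in Z) #|[set w' in E | z \in perp w']|)%nat.
  under eq_bigr => w' _ do rewrite -sum1_card.
  under [RHS]eq_bigr => z _ do rewrite -sum1_card.
  rewrite (exchange_big_dep (mem Z)) /=; last by move=> w' z _; rewrite inE => /andP[].
  apply: eq_bigr => z zZ; apply: eq_bigl => w'.
  by rewrite in_setI zZ [RHS]in_set.
have h1 : (t * t.-1 <= \sum_(w' in E) #|Z :&: perp w'|)%nat.
  by rewrite -{1}cE -sum_nat_const; apply: leq_sum => w' /low.
have h2 : (\sum_(z in Z) #|[set w' in E | z \in perp w']| <= (s * t.+1).+1 * s.+1)%nat.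
  apply: (@leq_trans (\sum_(z in Z) s.+1)%nat); first by apply: leq_sum => z /up.
  rewrite sum_nat_const leq_mul2r /= -(card_perp w); exact/subset_leq_card/subsetDl.
have := leq_trans h1 (eq_leq dc) ; move/leq_trans => /(_ _ h2).
clear -s2 t2; case: t t2 => // n _ /= H; rewrite leqNgt; apply/negP => big.
(* With t = n+1 and n >= 2 s^2, the count reduces to s^2 n <= s n + 3s + 1, which fails since s >= 2
   and n >= 8. *)
have {}big : (2 * (s * s) <= n)%nat by lia.
have h3 : (2 * (s * s) * n.+1 <= n.+1 * n)%nat by rewrite mulnC leq_mul2l big orbT.
have h4 : (2 * s <= s * s)%nat by rewrite leq_mul2r s2 orbT.
have h5 : (2 * s * n <= s * s * n)%nat by rewrite leq_mul2r h4 orbT.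
have h6 : (s * s * 8 <= s * s * n)%nat by rewrite leq_mul2l; apply/orP; right; lia.
have e1 : (2 * (s * s) * n.+1 = 2 * (s * s * n) + 2 * (s * s))%nat by lia.
have e2 : ((s * n.+2).+1 * s.+1 = s * s * n + s * n + 2 * (s * s) + 3 * s + 1)%nat by lia.
lia.
Qed.

End Geometry.

(** * The three stages *)

Lemma ln_le x y : 0 < x -> x <= y -> ln x <= ln y.
Proof. by move=> x0 [/(ln_increasing _ _ x0)|->]; lra. Qed.

(** * Numerical estimates for stage 1 *)

Section FirstRate.
Variables (s t L : R).
Hypotheses (L1000 : 1000 <= L) (sE : s = exp L) (tlow : s * L ^ 8 <= t) (tup : t <= 2 * s ^ 2).

(** 320 is what makes [slack * density / (2 * L)] equal to 20 L, twice the exponent 10 L used in the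
    union bounds. *)
Definition density := 320 * L ^ 4.
(** Chosen so that t+1 available neighbours give survival probability sM/t. *)
Definition rate1 := ln (t / (s * density)) / (t + 1).
(** Plays the role of [eta]: the exponent is at most L, so this perturbs survival by a fraction of
    only about 1/(8L). *)
Definition slack := / (8 * L ^ 2).

Let M := density.
Let m0 := ln (t / (s * M)).

Lemma s_ge : 1000 * L <= s.
Proof.
have -> : s = exp (L / 2) * exp (L / 2) by rewrite -exp_plus sE; congr exp; lra.
have -> : exp (L / 2) = exp (L / 4) * exp (L / 4) by rewrite -exp_plus; congr exp; lra.
have h := exp_ineq1_le (L / 4); set e := exp _ in h *.
have e250 : L / 4 <= e by lra.
have h1 : L / 4 * (L / 4) <= e * e by apply: Rmult_le_compat; lra.
have h2 : (L / 4 * (L / 4)) * (L / 4 * (L / 4)) <= e * e * (e * e) by apply: Rmult_le_compat; nra.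
have h3 : 250 * 250 <= L / 4 * (L / 4) by apply: Rmult_le_compat; lra.
have h4 : 250 * (L / 4) <= L / 4 * (L / 4) by apply: Rmult_le_compat_r; lra.
have h5 : (250 * 250) * (250 * (L / 4)) <= (L / 4 * (L / 4)) * (L / 4 * (L / 4)).
  by apply: Rmult_le_compat; lra.
lra.
Qed.

Lemma L_pow n : 1000 * L ^ n <= L ^ n.+1.
Proof.
have := pow_le L n ltac:(lra) => h /=; exact: Rmult_le_compat_r.
Qed.

Lemma Ln_ge1 n : 1 <= L ^ n.
Proof. by apply: pow_R1_Rle; lra. Qed.

Lemma M_ge : L <= M /\ 0 < M.
Proof.
have := L_pow 1; have := L_pow 2; have := L_pow 3; rewrite pow_1 /M /density => *; lra.
Qed.

Lemma sM_gt0 : 0 < s * M.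
Proof. by apply: Rmult_lt_0_compat; [have := s_ge; lra | have [] := M_ge]. Qed.

Lemma t_ge : 1000 * s * L ^ 7 <= t.
Proof.
apply: Rle_trans tlow; have := L_pow 7; have := s_ge; nra.
Qed.

Lemma t_gt0 : 0 < t.
Proof.
apply: Rlt_le_trans t_ge; apply: Rmult_lt_0_compat; first by have := s_ge; lra.
by apply: pow_lt; lra.
Qed.

Lemma s_le_t : s <= t.
Proof.
apply: Rle_trans t_ge; have := s_ge; have := Rmult_le_compat_l (1000 * s) _ _ ltac:(have := s_ge; lra) (Ln_ge1 7).
lra.
Qed.

Lemma sM_le_t : s * M <= t.
Proof.
apply: Rle_trans tlow; apply: Rmult_le_compat_l; first by have := s_ge; lra.
have := L_pow 4; have := L_pow 5; have := L_pow 6; have := L_pow 7; rewrite /M /density.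
have := Ln_ge1 4; lra.
Qed.

Lemma exp_m0 : exp (- m0) = s * M / t.
Proof.
have h1 := sM_gt0; have h2 := t_gt0.
have [_ M0] := M_ge; have s0 := s_ge.
rewrite exp_Ropp /m0 exp_ln; first by field; repeat split; lra.
by apply: Rdiv_lt_0_compat.
Qed.

(** The upper bound is where t <= 2 s^2 enters: t/(sM) <= 2s/M <= s. *)
Lemma m0_bounds : 0 <= m0 <= L.
Proof.
have h1 := sM_gt0; have h2 := t_gt0.
have q0 : 0 < t / (s * M) by exact: Rdiv_lt_0_compat.
split.
  rewrite -ln_1; apply: ln_le; first by lra.
  by apply: (Rmult_le_reg_r (s * M)) => //; rewrite /Rdiv Rmult_assoc Rinv_l; have := sM_le_t; lra.
rewrite -(ln_exp L) -sE; apply: ln_le => //.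
apply: (Rmult_le_reg_r (s * M)) => //; rewrite {1}/Rdiv Rmult_assoc Rinv_l; last by lra.
have [M1 M0] := M_ge; have := s_ge; move: tup => /= *; nra.
Qed.

Lemma rate1_bounds : 0 <= rate1 /\ rate1 * (t + 1) = m0 /\ rate1 * t <= L.
Proof.
have h2 := t_gt0; have [m1 m2] := m0_bounds.
have e : rate1 * (t + 1) = m0 by rewrite /rate1 -/m0; field; lra.
have r0 : 0 <= rate1 by apply: Rmult_le_pos => //; apply/Rlt_le/Rinv_0_lt_compat; lra.
by split=> //; split=> //; nra.
Qed.

Lemma rate1_small : rate1 * (s + 1) <= / (16 * L) /\ rate1 <= / (64 * L ^ 2).
Proof.
have [r0 [_ rt]] := rate1_bounds; have h := s_ge; have ht := t_ge.
have L2 := L_pow 2; have L1 := L_pow 1; have L3 := L_pow 3.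
have L67 : 1000 * (L * L) <= L ^ 7.
  have := L_pow 6; have := L_pow 5; have := L_pow 4; rewrite pow_1 /= in L1 L2 L3 *; nra.
have X : 1000 * s * (1000 * (L * L)) <= t by apply: Rle_trans ht; apply: Rmult_le_compat_l; lra.
have s1 : 0 < s by lra.
have Y : rate1 * s * (1000 * (1000 * (L * L))) <= L.
  apply: Rle_trans rt; have -> : rate1 * s * (1000 * (1000 * (L * L))) = rate1 * (1000 * s * (1000 * (L * L))) by ring.
  exact: Rmult_le_compat_l.
have Z : rate1 * s * (1000 * 1000) * L <= 1.
  apply: (Rmult_le_reg_r L); first by lra.
  by rewrite Rmult_1_l; apply: Rle_trans Y; apply: Req_le; ring.
split.
  apply: (Rmult_le_reg_r (16 * L)); first by lra.
  rewrite Rinv_l; last by lra.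
  have : rate1 * (s + 1) <= rate1 * (2 * s) by apply: Rmult_le_compat_l; lra.
  move=> q; have : rate1 * (s + 1) * (16 * L) <= rate1 * (2 * s) * (16 * L) by apply: Rmult_le_compat_r; lra.
  have : 0 <= rate1 * s * L by apply: Rmult_le_pos; [apply: Rmult_le_pos|]; lra.
  lra.
rewrite /= Rmult_1_r.
apply: (Rmult_le_reg_r (64 * (L * L))); first by nra.
rewrite Rinv_l; last by nra.
have : rate1 * L * (1000 * L) <= rate1 * L * s by apply: Rmult_le_compat_l; [apply: Rmult_le_pos; lra | lra].
have : 0 <= rate1 * L * L by apply: Rmult_le_pos; [apply: Rmult_le_pos|]; lra.
lra.
Qed.

Lemma slack_bounds : 0 < slack /\ slack <= / 8 /\ slack * L = / (8 * L).
Proof.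
have h : slack * L = / (8 * L) by rewrite /slack; field; lra.
split; first by apply: Rinv_0_lt_compat; have := Ln_ge1 2; lra.
split=> //; apply: Rinv_le_contravar; first by lra.
by have := Ln_ge1 2; lra.
Qed.

(** The gain in the exponent from a deviation of sM/(2L) in the number of survivors. *)
Lemma slack_gain : 10 * L <= slack / (s + 1) * (s * M) * / (2 * L).
Proof.
have h := s_ge.
have -> : slack / (s + 1) * (s * M) * / (2 * L) = 20 * L * (s / (s + 1)).
  rewrite /slack /M /density; field; lra.
have : / 2 <= s / (s + 1); last by nra.
apply: (Rmult_le_reg_r (2 * (s + 1))); first by lra.
have -> : s / (s + 1) * (2 * (s + 1)) = 2 * s by field; lra.
lra.
Qed.

Lemma s_over_t : s / t <= / (8 * L).
Proof.
have ht := t_ge; have t0 := t_gt0; have L7 := L_pow 6; have L1 := Ln_ge1 5; have h := s_ge.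
apply: (Rmult_le_reg_r (8 * L * t)); first by nra.
have -> : s / t * (8 * L * t) = 8 * L * s by field; lra.
have -> : / (8 * L) * (8 * L * t) = t by field; lra.
apply: Rle_trans ht; have L6 : L <= L ^ 6 by have := Rmult_le_compat_l L _ _ ltac:(lra) L1; rewrite /=; lra.
have : 8 * L <= 1000 * L ^ 7 by lra.
move=> q; have := Rmult_le_compat_r s _ _ ltac:(lra) q; lra.
Qed.

(** Half of the tolerance 1/L absorbs the systematic errors ([slack], the second order in the rate,
    the s points lost out of t); the other half yields [slack_gain]. [upper_exponent] divides the
    tolerance in the same way. *)
Lemma lower_exponent n : t - s <= n ->
  slack / (s + 1) * ((1 - / L) * (s * M)) +
  - (slack / (s + 1) * n * exp (- (rate1 * (1 + slack) * (1 + 2 * (rate1 * (1 + slack))) * (t + 1))))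
   <= - (10 * L).
Proof.
move=> tn; have [r0 [rm rt]] := rate1_bounds; have [m1 m2] := m0_bounds.
have [e0 [e8 eL]] := slack_bounds; have [_ r64] := rate1_small; have t0 := t_gt0; have hs := s_ge.
have sM0 := sM_gt0.
have iL : 0 < / L by apply: Rinv_0_lt_compat; lra.
have E2 : / (8 * L) = / L / 8 by field; lra.
have gE : rate1 * (1 + slack) * (1 + 2 * (rate1 * (1 + slack))) * (t + 1)
   = m0 * ((1 + slack) * (1 + 2 * (rate1 * (1 + slack)))) by rewrite -rm; ring.
have g1 : (1 + slack) * (1 + 2 * (rate1 * (1 + slack))) <= 1 + (slack + 4 * rate1).
  have h1 : (1 + slack) * (1 + slack) <= 2 by nra.
  have : rate1 * ((1 + slack) * (1 + slack)) <= rate1 * 2 by exact: Rmult_le_compat_l.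
  nra.
have g2 : m0 * (slack + 4 * rate1) <= / (8 * L) + / (8 * L).
  have : m0 * (slack + 4 * rate1) <= L * (slack + 4 * rate1) by apply: Rmult_le_compat_r; lra.
  have : L * rate1 <= L * / (64 * L ^ 2) by apply: Rmult_le_compat_l; lra.
  have : L * / (64 * L ^ 2) = / (8 * L) / 8 by field; lra.
  have : 0 < / (8 * L) by apply: Rinv_0_lt_compat; lra.
  lra.
have g3 : m0 * ((1 + slack) * (1 + 2 * (rate1 * (1 + slack)))) <= m0 + / L / 4.
  have := Rmult_le_compat_l _ _ _ m1 g1; rewrite E2 in g2; lra.
have lb : s * M / t * (1 - / L / 4) <= exp (- (rate1 * (1 + slack) * (1 + 2 * (rate1 * (1 + slack))) * (t + 1))).
  rewrite gE -exp_m0; apply: (Rle_trans _ (exp (- m0) * exp (- (/ L / 4)))).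
    by apply: Rmult_le_compat_l; [exact/Rlt_le/exp_pos | exact: one_minus_le_exp].
  by rewrite -exp_plus; apply: exp_le; lra.
set X := exp _ in lb *.
have lam0 : 0 < slack / (s + 1) by apply: Rdiv_lt_0_compat; lra.
have nX : s * M * (1 - / L / 2) <= n * X.
  apply: (Rle_trans _ ((t - s) * (s * M / t * (1 - / L / 4)))); last first.
    have iL1 : / L <= 1 by rewrite -[X in _ <= X]Rinv_1; apply: Rinv_le_contravar; lra.
    apply: Rmult_le_compat => //.
      by have := s_le_t; lra.
    apply: Rmult_le_pos; last by lra.
    by apply/Rlt_le/Rdiv_lt_0_compat.
  have -> : (t - s) * (s * M / t * (1 - / L / 4)) = s * M * ((1 - s / t) * (1 - / L / 4)) by field; lra.
  apply: Rmult_le_compat_l; first by lra.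
  have := s_over_t; rewrite E2 => sot.
  have : 0 < s / t by apply: Rdiv_lt_0_compat; lra.
  nra.
have := Rmult_le_compat_l _ _ _ (Rlt_le _ _ lam0) nX.
have := slack_gain.
have -> : / (2 * L) = / L / 2 by field; lra.
set lam := slack / (s + 1); move=> *.
have -> : lam * n * X = lam * (n * X) by ring.
nra.
Qed.

Lemma upper_exponent n : 0 <= n <= t + 1 ->
  slack / (s + 1) * n * exp (- (rate1 * (1 - slack) * (t - s)))
   - slack / (s + 1) * ((1 + / L) * (s * M)) <= - (10 * L).
Proof.
move=> [n0 nt]; have [r0 [rm rt]] := rate1_bounds; have [m1 m2] := m0_bounds.
have [e0 [e8 eL]] := slack_bounds; have [r16 r64] := rate1_small; have t0 := t_gt0; have hs := s_ge.
have sM0 := sM_gt0.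
have iL : 0 < / L by apply: Rinv_0_lt_compat; lra.
have iL1 : / L <= / 1000 by apply: Rinv_le_contravar; lra.
have E2 : / (8 * L) = / L / 8 by field; lra.
have E16 : / (16 * L) = / L / 16 by field; lra.
have g : m0 - 3 * (/ L / 16) <= rate1 * (1 - slack) * (t - s).
  have -> : rate1 * (1 - slack) * (t - s) = rate1 * (t + 1) - rate1 * (s + 1) - slack * (rate1 * (t + 1)) + slack * (rate1 * (s + 1)) by ring.
  rewrite rm; have : slack * m0 <= slack * L by apply: Rmult_le_compat_l; lra.
  have : 0 <= slack * (rate1 * (s + 1)) by apply: Rmult_le_pos; [lra | apply: Rmult_le_pos; lra].
  rewrite E16 in r16; rewrite E2 in eL; lra.
have ub : exp (- (rate1 * (1 - slack) * (t - s))) <= s * M / t * (1 + / L / 4).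
  apply: (Rle_trans _ (exp (- m0) * exp (3 * (/ L / 16)))).
    by rewrite -exp_plus; apply: exp_le; lra.
  rewrite exp_m0; apply: Rmult_le_compat_l; first by apply/Rlt_le/Rdiv_lt_0_compat.
  have := exp_le_quadratic (z := 3 * (/ L / 16)) ltac:(lra); nra.
set X := exp _ in ub *.
have lam0 : 0 < slack / (s + 1) by apply: Rdiv_lt_0_compat; lra.
have X0 : 0 < X by exact: exp_pos.
have nX : n * X <= s * M * (1 + / L / 2).
  apply: (Rle_trans _ ((t + 1) * (s * M / t * (1 + / L / 4)))).
    by apply: Rmult_le_compat; lra.
  have -> : (t + 1) * (s * M / t * (1 + / L / 4)) = s * M * ((1 + / t) * (1 + / L / 4)) by field; lra.
  apply: Rmult_le_compat_l; first by lra.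
  have it : / t <= / L / 8.
    rewrite -E2; apply: Rinv_le_contravar; first by lra.
    by have := s_le_t; lra.
  have : 0 < / t by exact: Rinv_0_lt_compat.
  nra.
have := Rmult_le_compat_l _ _ _ (Rlt_le _ _ lam0) nX.
have := slack_gain.
have -> : / (2 * L) = / L / 2 by field; lra.
set lam := slack / (s + 1); move=> *.
have -> : lam * n * X = lam * (n * X) by ring.
nra.
Qed.

End FirstRate.

Lemma Ex_survivors (T : finType) (N : T -> {set T}) r ls (B : {set T}) d :
  (forall u a, (u \in N a) = (a \in N u)) -> admissible r ls ->
  (forall a, a \in B -> d <= mu ls (N a)) ->
  Ex r ls (fun S => INR #|B :\: nbr N S|) <= INR #|B| * exp (- (r * d)).
Proof.
move=> N_sym adm Hd; have [r0 _] := adm.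
rewrite (@Ex_ext _ r ls _ (fun S => \rsum_(a in B) ind [disjoint S & N a])); last first.
  move=> S; rewrite setDE -rsum_ind_card; apply: eq_bigr => a _.
  by rewrite disjoint_nbr // inE.
rewrite Ex_sum -rsum_set_const; apply: rsum_le => a aB.
apply: Rle_trans (Ex_disjoint _ adm) _; apply/exp_le/Ropp_le_contravar.
by apply: Rmult_le_compat_l => //; exact: Hd.
Qed.

(** * Stage 1 seen from one uncovered point *)

Section FirstStage.
Variables (Pt Ln : finType) (I : Pt -> Ln -> bool) (s t : nat) (L : R).
Hypotheses (gq : is_GQ I s t) (sparse : locally_sparse I s)
  (L1000 : 1000 <= L) (sE : INR s = exp L)
  (tlow : INR s * L ^ 8 <= INR t) (tup : INR t <= 2 * INR s ^ 2).
Notation perp := (perp I).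
Notation pencil := (pencil I).
Let sR := INR s.
Let tR := INR t.
Let M := density L.
Let r1 := rate1 sR tR L.
Let N_sym := perp_sym I.

(** With t <= 2 s^2 there are at most s^5 points, so a failure probability of order e^(-10L)
    survives a union over all of them. *)
Lemma card_points_exp (x : Pt) : INR #|Pt| <= exp (5 * L).
Proof.
have h := le_INR _ _ (leP (card_points gq x)); apply: Rle_trans h _.
have hs := s_ge L1000 sE.
have -> : exp (5 * L) = INR s * (INR s * (INR s * (INR s * INR s))).
  by rewrite sE -!exp_plus; congr exp; lra.
rewrite mult_INR !S_INR mult_INR S_INR.
have s1000 : 1000 <= INR s by lra.
have tup' := tup; rewrite -/tR in tup' *; set a := INR s in s1000 tup' *.
have h1 : a * (tR + 1) + 1 <= 4 * (a * (a * a)).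
  have : a * (tR + 1) <= a * (2 * a ^ 2 + 1) by apply: Rmult_le_compat_l; lra.
  rewrite /=; nra.
apply: (Rle_trans _ ((2 * a) * (4 * (a * (a * a))))).
  apply: Rmult_le_compat; try lra.
  by have := pos_INR t; rewrite -/tR; nra.
have : 0 < a * (a * (a * a)) by repeat (apply: Rmult_lt_0_compat; try lra).
nra.
Qed.

Lemma rate1_admissible x B : admissible r1 (restrict (pencil x) B).
Proof.
have [r0 _] := rate1_bounds L1000 sE tlow tup.
have [r16 _] := rate1_small L1000 sE tlow tup.
apply: (pencil_admissible gq) => //; rewrite -/sR.
have : / (16 * L) <= / 1 by apply: Rinv_le_contravar; lra.
rewrite Rinv_1 => h; rewrite -/sR -/tR -/r1 in r0 r16.
by rewrite Rmult_plus_distr_l in r16; lra.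
Qed.

Section OneVertex.
Variables (x w b : Pt).
Hypotheses (wx : w != x) (wb : w \notin perp b) (bx : b \notin perp x).
Let A := (perp b :&: perp w) :\: perp x.
(** Deleting [perp w] conditions on [w] staying uncovered. The intersection with [setT] lets
    [restrictI] match the unconditioned lines. *)
Let ls := restrict (pencil x) (setT :&: ~: perp w).

Lemma card_A_ge : tR - sR <= INR #|A| <= tR + 1.
Proof.
have bw : b != w by rewrite eq_sym; exact: (notin_perp_neq gq wb).
have bNx : b != x by exact: (notin_perp_neq gq bx).
have := card_triple sparse bw bNx wx.
have := cardsID (perp x) (perp b :&: perp w); rewrite (card_common gq wb) -/A => c1 c2.
have : INR t <= INR (#|A| + s) by apply: le_INR; lia.
have : INR #|A| <= INR t.+1 by apply: le_INR; lia.
by rewrite plus_INR S_INR /tR /sR; lra.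
Qed.

Lemma A_card1 a k : a \in A -> k \in ls -> (#|k :&: perp a| <= 1)%nat.
Proof. by rewrite inE => /andP[ax _]; exact: (pencil_card1 gq ax). Qed.

(** The deletion of [perp w] forces u to differ from w, and b off [perp x] forces it to differ from
    b; so the class lies in the common neighbourhood of three distinct points. *)
Lemma A_class k u : k \in ls -> u \in k -> INR #|A :&: perp u| <= sR + 1.
Proof.
case/mapP=> k' /pencilP[l xl ->] -> {k k'}; rewrite !inE => /andP[/andP[ul ux] uw].
rewrite /sR -S_INR; apply: le_INR.
have bw : b != w by rewrite eq_sym; exact: (notin_perp_neq gq wb).
have bu : b != u by apply: contra bx => /eqP ->; rewrite inE; exact: (collinearP ul xl).
have wu : w != u by apply: contra uw => /eqP ->; exact: (collinear_refl gq).
apply/leP; apply: leq_trans (card_triple sparse bw bu wu).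
exact/subset_leq_card/setSI/subsetDl.
Qed.

Lemma A_mu a : a \in A -> tR - sR <= mu ls (perp a) <= tR + 1.
Proof.
rewrite !inE => /andP[ax /andP[ab aw]].
have ax' : a \notin perp x by rewrite inE.
rewrite /ls (mu_pencil gq) setTI.
have -> : (perp x :\ x) :&: ~: perp w :&: perp a = (perp x :&: perp a) :\: perp w.
  apply/setP => u; rewrite !inE; case: (altP (u =P x)) => [->|_] /=.
    by rewrite [collinear I x a]collinear_sym (negbTE ax) !andbF.
  by case: (collinear I u x); case: (collinear I u w); case: (collinear I u a).
have aw' : a != w by apply: contra wb => /eqP <-; rewrite inE.
have xa : x != a by rewrite eq_sym; exact: (notin_perp_neq gq ax').
have xw : x != w by rewrite eq_sym.
have := card_triple sparse xa xw aw'.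
have := cardsID (perp w) (perp x :&: perp a); rewrite (card_common gq ax') => c1 c2.
set n := #|_ :\: perp w| in c1 *.
have : INR t <= INR (n + s) by apply: le_INR; lia.
have : INR n <= INR t.+1 by apply: le_INR; lia.
by rewrite plus_INR S_INR /tR /sR; lra.
Qed.

Let lam := slack L / (sR + 1).

(** The potential is nonnegative and exceeds 1 as soon as [w] is uncovered and either bound of
    [balanced] fails, so its sum over [w] is a union bound for both tails. *)
Lemma stage1_vertex :
  Ex r1 (restrict (pencil x) setT) (fun S => ind (w \notin nbr perp S) *
    (exp (lam * ((1 - / L) * (sR * M)) + - (lam * INR #|A :\: nbr perp S|))
     + exp (lam * INR #|A :\: nbr perp S| - lam * ((1 + / L) * (sR * M)))))
   <= 2 * exp (- (10 * L)).
Proof.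
have adm := rate1_admissible x setT.
have adm' : admissible r1 ls by exact: rate1_admissible.
have [e0 [e8 _]] := slack_bounds L1000.
have [r0 _] := rate1_bounds L1000 sE tlow tup.
have [_ r64] := rate1_small L1000 sE tlow tup.
have r4 : r1 <= / 4.
  apply: Rle_trans r64 _; apply: Rinv_le_contravar; first by lra.
  by have := Ln_ge1 L1000 2; lra.
have eta4 : 0 <= slack L <= / 4 by lra.
have k0 : 0 < sR + 1 by have := pos_INR s; rewrite -/sR; lra.
have [cA1 cA2] := card_A_ge.
have low := lower_tail N_sym adm' eta4 k0 r4 A_card1 A_class (fun a aA => proj2 (A_mu aA)).
have upp := upper_tail N_sym adm' eta4 k0 r4 A_card1 A_class (fun a aA => proj1 (A_mu aA)).
have lE := lower_exponent L1000 sE tlow tup cA1.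
have uE := upper_exponent L1000 sE tlow tup (conj (pos_INR #|A|) cA2).
rewrite -/lam -/sR -/tR -/M -/r1 in low upp lE uE.
set c1 := lam * ((1 - / L) * (sR * M)) in lE *.
set c2 := lam * ((1 + / L) * (sR * M)) in uE *.
apply: (Rle_trans _ (Ex r1 ls (fun S => exp c1 * exp (- (lam * INR #|A :\: nbr perp S|))
  + exp (- c2) * exp (lam * INR #|A :\: nbr perp S|)))).
  rewrite /ls -restrictI; apply: Rle_trans (Ex_restrict (perp w) adm _); last first.
    move=> S; apply: Rplus_le_le_0_compat; apply: Rmult_le_pos; exact/Rlt_le/exp_pos.
  apply: Ex_le => // S; rewrite disjoint_nbr // -!exp_plus.
  apply: Req_le; congr (_ * (_ + _)); congr exp; ring.
rewrite ExD !ExZ.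
have := Rmult_le_compat_l _ _ _ (Rlt_le _ _ (exp_pos c1)) low.
have := Rmult_le_compat_l _ _ _ (Rlt_le _ _ (exp_pos (- c2))) upp.
rewrite -!exp_plus.
have := exp_le lE; have := exp_le uE.
have -> : forall p, p - c2 = - c2 + p by move=> p; ring.
lra.
Qed.

End OneVertex.
End FirstStage.

(** * Stage 1: choice of S *)

Section FirstStageSet.
Variables (Pt Ln : finType) (I : Pt -> Ln -> bool) (s t : nat) (L : R).
Hypotheses (gq : is_GQ I s t) (sparse : locally_sparse I s)
  (L1000 : 1000 <= L) (sE : INR s = exp L)
  (tlow : INR s * L ^ 8 <= INR t) (tup : INR t <= 2 * INR s ^ 2).
Notation perp := (perp I).
Notation pencil := (pencil I).
Let sR := INR s.
Let tR := INR t.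
Let M := density L.
Let r1 := rate1 sR tR L.
Let N_sym := perp_sym I.
Variables (x y z : Pt).
Hypotheses (yx : y \notin perp x) (zx : z \notin perp x) (yz : y \notin perp z).

Lemma Ex_survivors_stage1 (B : {set Pt}) : [disjoint B & perp x] ->
  Ex r1 (restrict (pencil x) setT) (fun S => INR #|B :\: nbr perp S|)
   <= INR #|B| * (sR * M / tR).
Proof.
move=> Bx; have [_ [rm _]] := rate1_bounds L1000 sE tlow tup.
rewrite -(exp_m0 L1000 sE tlow) -[ln _]rm.
apply: Ex_survivors => //; first exact: rate1_admissible.
move=> a aB; have ax : a \notin perp x by rewrite (disjointFr Bx).
rewrite (mu_pencil gq) setIT -S_INR -(card_common gq ax).
apply/le_INR/leP/subset_leq_card/subsetP => u; rewrite !inE => /andP[ux ua].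
rewrite ux ua !andbT; apply: contra ax => /eqP <-.
by rewrite inE collinear_sym.
Qed.

(** The case b = y gives the degrees used in stage 2, b = z those used in stages 2 and 3. Points of
    [perp x] are left out because the tail bounds do not reach them; where they matter, sparsity
    adds back at most s+1. *)
Definition balanced (S : {set Pt}) := forall w b, b \in [:: y; z] ->
  w \notin nbr perp S -> w != x -> w \notin perp b ->
  (1 - / L) * (sR * M) <= INR #|((perp b :&: perp w) :\: perp x) :\: nbr perp S|
    <= (1 + / L) * (sR * M).

Lemma first_stage : exists S, [/\ outcome (restrict (pencil x) setT) S,
  INR #|S| <= 8 * (L * sR),
  forall b, b \in [:: y; z] -> INR #|(perp b :\: perp x) :\: nbr perp S| <= 16 * (sR * (sR * M)),
  INR #|((perp y :&: perp z) :\: perp x) :\: nbr perp S| <= 16 * (sR * M) &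
  balanced S].
Proof.
have adm := rate1_admissible gq L1000 sE tlow tup x setT.
have hs := s_ge L1000 sE; have t0 := t_gt0 L1000 sE tlow; have [M1 M0] := M_ge L1000.
have st := s_le_t L1000 sE tlow.
rewrite -/sR -/tR -/M -/r1 in adm hs t0 M1 M0 st.
have s0 : 0 < sR by lra.
have sM0 : 0 < sR * M by exact: Rmult_lt_0_compat.
have Ls0 : 0 < L * sR by apply: Rmult_lt_0_compat; lra.
have ssM0 : 0 < sR * (sR * M) by exact: Rmult_lt_0_compat.
pose ls := restrict (pencil x) setT.
pose lam := slack L / (sR + 1).
have lam0 : 0 < lam by have [e0 _] := slack_bounds L1000; apply: Rdiv_lt_0_compat; lra.
pose X b w S := INR #|((perp b :&: perp w) :\: perp x) :\: nbr perp S|.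
pose G b w S := ind (w \notin nbr perp S) *
    (exp (lam * ((1 - / L) * (sR * M)) + - (lam * X b w S))
     + exp (lam * X b w S - lam * ((1 + / L) * (sR * M)))).
pose W b := [set w | (w != x) && (w \notin perp b)].
pose P b S := INR #|(perp b :\: perp x) :\: nbr perp S|.
pose Q S := INR #|((perp y :&: perp z) :\: perp x) :\: nbr perp S|.
have G0 b w S : 0 <= G b w S.
  apply: Rmult_le_pos; first exact: ind_ge0.
  by apply: Rplus_le_le_0_compat; exact/Rlt_le/exp_pos.
(* Six nonnegative terms, each of expectation at most 1/8: the size thresholds are eight times the
   bounds on the means. A value below 1 therefore gives all the properties at once. *)
pose F (S : {set Pt}) := / (8 * (L * sR)) * INR #|S| +
  (/ (16 * (sR * (sR * M))) * P y S + (/ (16 * (sR * (sR * M))) * P z S +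
  (/ (16 * (sR * M)) * Q S +
  (\rsum_(w in W y) G y w S + \rsum_(w in W z) G z w S)))).
have ES : Ex r1 ls (fun S => INR #|S|) <= L * sR.
  apply: Rle_trans (Ex_card adm) _.
  have -> : \rsum_(l <- restrict (pencil x) setT) INR #|l| = mu ls setT.
    by apply: eq_bigr => l _; rewrite setIT.
  rewrite (mu_pencil gq) !setIT (card_perpD1 gq) mult_INR S_INR -/sR -/tR.
  have [_ [rm _]] := rate1_bounds L1000 sE tlow tup.
  have [_ mL] := m0_bounds L1000 sE tlow tup.
  rewrite -/sR -/tR -/M -/r1 in rm mL.
  have -> : r1 * (sR * (tR + 1)) = (r1 * (tR + 1)) * sR by ring.
  by rewrite rm; apply: Rmult_le_compat_r; lra.
have EP b : Ex r1 ls (P b) <= 2 * (sR * (sR * M)).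
  apply: Rle_trans (Ex_survivors_stage1 _) _.
    by rewrite disjoints_subset; apply/subsetP => a; rewrite !inE => /andP[].
  apply: (Rle_trans _ ((sR * (tR + 1) + 1) * (sR * M / tR))).
    apply: Rmult_le_compat_r; first by apply/Rlt_le/Rdiv_lt_0_compat.
    rewrite /sR /tR -S_INR -mult_INR -S_INR -(card_perp gq b).
    exact/le_INR/leP/subset_leq_card/subsetDl.
  have -> : (sR * (tR + 1) + 1) * (sR * M / tR) = (sR * M) * ((sR * (tR + 1) + 1) / tR) by field; lra.
  have -> : 2 * (sR * (sR * M)) = (sR * M) * (2 * sR) by ring.
  apply: Rmult_le_compat_l; first by lra.
  apply: (Rmult_le_reg_r tR) => //.
  have -> : (sR * (tR + 1) + 1) / tR * tR = sR * tR + sR + 1 by field; lra.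
  have : 2 * sR <= sR * tR by have := Rmult_le_compat_l sR 2 tR ltac:(lra) ltac:(lra); lra.
  lra.
have EQ : Ex r1 ls Q <= 2 * (sR * M).
  apply: Rle_trans (Ex_survivors_stage1 _) _.
    by rewrite disjoints_subset; apply/subsetP => a; rewrite !inE => /andP[].
  apply: (Rle_trans _ ((tR + 1) * (sR * M / tR))).
    apply: Rmult_le_compat_r; first by apply/Rlt_le/Rdiv_lt_0_compat.
    rewrite /tR -S_INR -(card_common gq yz) [perp z :&: _]setIC.
    exact/le_INR/leP/subset_leq_card/subsetDl.
  have -> : (tR + 1) * (sR * M / tR) = (sR * M) * ((tR + 1) / tR) by field; lra.
  rewrite [2 * _]Rmult_comm; apply: Rmult_le_compat_l; first by lra.
  apply: (Rmult_le_reg_r tR) => //.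
  have -> : (tR + 1) / tR * tR = tR + 1 by field; lra.
  lra.
have EG b : b \notin perp x -> Ex r1 ls (fun S => \rsum_(w in W b) G b w S) <= / 8.
  move=> bx; rewrite Ex_sum.
  apply: (Rle_trans _ (\rsum_(w in W b) (2 * exp (- (10 * L))))).
    apply: rsum_le => w; rewrite inE => /andP[wx wb].
    exact: (stage1_vertex gq sparse L1000 sE tlow tup wx wb bx).
  rewrite rsum_set_const.
  apply: (Rle_trans _ (exp (5 * L) * (2 * exp (- (10 * L))))).
    apply: Rmult_le_compat_r; first by have := exp_pos (- (10 * L)); lra.
    apply: Rle_trans (card_points_exp gq L1000 sE tup x).
    exact/le_INR/leP/max_card.
  have -> : exp (5 * L) * (2 * exp (- (10 * L))) = 2 * exp (- (5 * L)).
    have -> : - (5 * L) = 5 * L + - (10 * L) by ring.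
    by rewrite exp_plus; ring.
  have h := exp_ineq1_le (5 * L); rewrite exp_Ropp.
  have : / exp (5 * L) <= / 16 by apply: Rinv_le_contravar; lra.
  lra.
have EF : Ex r1 ls F < 1.
  rewrite /F !ExD !ExZ.
  have h1 : / (8 * (L * sR)) * Ex r1 ls (fun S => INR #|S|) <= / 8.
    apply: (Rle_trans _ (/ (8 * (L * sR)) * (L * sR))).
      by apply: Rmult_le_compat_l => //; apply/Rlt_le/Rinv_0_lt_compat; lra.
    by apply: Req_le; field; lra.
  have h2 b : / (16 * (sR * (sR * M))) * Ex r1 ls (P b) <= / 8.
    apply: (Rle_trans _ (/ (16 * (sR * (sR * M))) * (2 * (sR * (sR * M))))).
      by apply: Rmult_le_compat_l => //; apply/Rlt_le/Rinv_0_lt_compat; lra.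
    by apply: Req_le; field; lra.
  have h3 : / (16 * (sR * M)) * Ex r1 ls Q <= / 8.
    apply: (Rle_trans _ (/ (16 * (sR * M)) * (2 * (sR * M)))).
      by apply: Rmult_le_compat_l => //; apply/Rlt_le/Rinv_0_lt_compat; lra.
    by apply: Req_le; field; lra.
  have := h2 y; have := h2 z; have := EG y yx; have := EG z zx; lra.
have [S oS FS] := Ex_outcome adm EF; exists S.
have T1 : 0 <= / (8 * (L * sR)) * INR #|S|.
  by apply: Rmult_le_pos; [apply/Rlt_le/Rinv_0_lt_compat; lra | exact: pos_INR].
have T2 b : 0 <= / (16 * (sR * (sR * M))) * P b S.
  by apply: Rmult_le_pos; [apply/Rlt_le/Rinv_0_lt_compat; lra | exact: pos_INR].
have T3 : 0 <= / (16 * (sR * M)) * Q S.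
  by apply: Rmult_le_pos; [apply/Rlt_le/Rinv_0_lt_compat; lra | exact: pos_INR].
have T4 b : 0 <= \rsum_(w in W b) G b w S by apply: rsum_ge0.
have := T2 y; have := T2 z; have := T4 y; have := T4 z => T4z T4y T2z T2y.
have cancel c v : 0 < c -> / c * v < 1 -> v <= c.
  move=> c0 h; apply: Rlt_le; have := Rmult_lt_compat_l _ _ _ c0 h.
  by rewrite -Rmult_assoc Rinv_r; lra.
rewrite /F in FS; split=> //.
- by apply: cancel; lra.
- by move=> b; rewrite -/(P b S) !inE => /orP[] /eqP ->; apply: cancel; lra.
- by apply: cancel; rewrite -/(Q S); lra.
- move=> w b bb wS wx wb; rewrite -/(X b w S).
  have Gb : \rsum_(w in W b) G b w S < 1.
    by move: bb; rewrite !inE => /orP[] /eqP ->; lra.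
  have : G b w S < 1.
    apply: Rle_lt_trans Gb; apply: (rsum_ge_term (F := fun w => G b w S)) => //.
    by rewrite inE wx.
  rewrite /G wS /= Rmult_1_l; set e1 := exp _; set e2 := exp _ => e12.
  have e1p : 0 < e1 by exact: exp_pos.
  have e2p : 0 < e2 by exact: exp_pos.
  have exp_lt1 v : exp v < 1 -> v < 0.
    by move=> h; apply: exp_lt_inv; rewrite exp_0.
  have l1 : lam * ((1 - / L) * (sR * M)) + - (lam * X b w S) < 0 by apply: exp_lt1; rewrite -/e1; lra.
  have l2 : lam * X b w S - lam * ((1 + / L) * (sR * M)) < 0 by apply: exp_lt1; rewrite -/e2; lra.
  split; apply: (Rmult_le_reg_l lam) => //; [clear l2|clear l1].
    by move: l1; set u := lam * _; set v := lam * _; lra.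
  by move: l2; set u := lam * _; set v := lam * _; lra.
Qed.

End FirstStageSet.

(** * Numerical estimates for stage 2 *)

Section SecondRate.
Variables (s L : R) (j : nat).
Hypotheses (L1000 : 1000 <= L) (sE : s = exp L) (j20 : 20 * L <= INR j) (j21 : INR j <= 21 * L).

(** About sM available neighbours give the exponent L, that is, survival probability about 1/s; a
    relative error O(1/L) in the degree costs only a constant factor. *)
Definition rate2 := L / (s * density L).
Let M := density L.
Let d0 := (1 - / L) * (s * M).

Lemma density_big : 1000 * (1000 * (320 * (L * L))) <= M.
Proof.
have := L_pow L1000 3; have := L_pow L1000 2; rewrite /M /density /= Rmult_1_r; lra.
Qed.

Lemma rate2_mul c : rate2 * (c * (s * M)) = c * L.
Proof.
have h := s_ge L1000 sE; have [_ M0] := M_ge L1000; rewrite -/M in M0.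
by rewrite /rate2 -/M; field; lra.
Qed.

Lemma rate2_ge0 : 0 <= rate2.
Proof.
have := sM_gt0 L1000 sE => h; apply: Rmult_le_pos; first by lra.
exact/Rlt_le/Rinv_0_lt_compat.
Qed.

Lemma invL : 0 < / L /\ / L <= / 1000 /\ / L * L = 1.
Proof.
split; first by apply: Rinv_0_lt_compat; lra.
split; first by apply: Rinv_le_contravar; lra.
by field; lra.
Qed.

Lemma rate2_s : rate2 * s * (1000 * (1000 * (320 * L))) <= 1.
Proof.
have h := s_ge L1000 sE; have M0 := density_big; have [_ M1] := M_ge L1000; rewrite -/M in M1.
have E : rate2 * s * M = L by rewrite /rate2 -/M; field; lra.
apply: (Rmult_le_reg_r L); first by lra.
rewrite Rmult_1_l -[X in _ <= X]E.
have -> : rate2 * s * (1000 * (1000 * (320 * L))) * L = rate2 * s * (1000 * (1000 * (320 * (L * L)))) by ring.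
apply: Rmult_le_compat_l => //; apply: Rmult_le_pos; last by lra.
exact: rate2_ge0.
Qed.

Lemma rate2_small : rate2 * (1 + (INR j + 1) * (s + 1)) <= 1 /\ rate2 <= / (1000 * L) /\ rate2 * (s + 1) <= 1.
Proof.
have h := s_ge L1000 sE; have r0 := rate2_ge0; have rs := rate2_s; have j0 := pos_INR j.
have rsp : 0 <= rate2 * s by apply: Rmult_le_pos; lra.
have rs1 : rate2 * (s + 1) <= 2 * (rate2 * s).
  by have := Rmult_le_compat_l rate2 (s + 1) (2 * s) r0 ltac:(lra); lra.
have rsL : 0 <= rate2 * s * L by apply: Rmult_le_pos; lra.
have rss : rate2 * s <= rate2 * s * L.
  by have := Rmult_le_compat_l (rate2 * s) 1 L rsp ltac:(lra); lra.
split; last split; last by lra.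
  have : (INR j + 1) * (rate2 * (s + 1)) <= (22 * L) * (2 * (rate2 * s)).
    by apply: Rmult_le_compat => //; lra.
  have : rate2 <= rate2 * s by have := Rmult_le_compat_l rate2 1 s r0 ltac:(lra); lra.
  lra.
apply: (Rmult_le_reg_r (1000 * L)); first by lra.
rewrite Rinv_l; last by lra.
have : rate2 * L <= rate2 * s by apply: Rmult_le_compat_l; lra.
lra.
Qed.

Lemma exp4_le : exp 4 <= 81.
Proof.
have -> : exp 4 = exp 1 * exp 1 * (exp 1 * exp 1) by rewrite -!exp_plus; congr exp; lra.
have := exp_le_3; have := exp_pos 1; set e := exp 1 => e0 e3.
have : e * e <= 9 by nra.
nra.
Qed.

(** With eta = 1/L, this [lam] makes [INR j * lam] half of eta and leaves the other half as the base
    of the moment bound, whose ratio becomes (s+1)/j. *)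
Lemma lam2_bounds : let lam := / L / (2 * INR j) in
  [/\ 0 <= lam, / L - INR j * lam = / L / 2, INR j * lam = / L / 2,
   lam * ((2 * INR j + 1) * (10 * L)) <= 11 & / (42 * (L * L)) <= lam].
Proof.
have [i0 [i1 iL]] := invL; have j0 : 0 < INR j by lra.
have ij : 0 < / (2 * INR j) by apply: Rinv_0_lt_compat; lra.
rewrite /=; have e : INR j * (/ L / (2 * INR j)) = / L / 2 by field; lra.
split.
- by apply: Rmult_le_pos; lra.
- by rewrite e; lra.
- exact: e.
- have -> : / L / (2 * INR j) * ((2 * INR j + 1) * (10 * L)) = 10 + 5 / INR j by field; lra.
  suff : 5 / INR j <= 1 by lra.
  apply: (Rmult_le_reg_r (INR j)) => //.
  have -> : 5 / INR j * INR j = 5 by field; lra.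
  lra.
- have -> : / L / (2 * INR j) = / (2 * (INR j * L)) by field; lra.
  apply: Rinv_le_contravar; first by apply: Rmult_lt_0_compat; [lra | apply: Rmult_lt_0_compat; lra].
  have := Rmult_le_compat_r L _ _ ltac:(lra) j21; lra.
Qed.

(** [lam] is at least 1/(42 L^2), n at least sM/2 and survival at least 1/(81 s). The product is of
    order M/L^2, that is L^2, and L >= 1000 gives the rest. *)
Lemma second_main n : s * M / 2 <= n ->
  20 * L + 11 <= / L / (2 * INR j) * n *
    exp (- (rate2 * (1 + / L) * (1 + 2 * (rate2 * (1 + / L))) * ((1 + 2 / L) * (s * M)))).
Proof.
move=> hn; have [i0 [i1 iL]] := invL; have [lam0 _ _ _ lam1] := lam2_bounds.
have r0 := rate2_ge0; have [_ [r1 _]] := rate2_small; have hs := s_ge L1000 sE.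
have E3 : / (1000 * L) = / L / 1000 by field; lra.
have g : rate2 * (1 + / L) * (1 + 2 * (rate2 * (1 + / L))) * ((1 + 2 / L) * (s * M)) <= L + 4.
  have -> : rate2 * (1 + / L) * (1 + 2 * (rate2 * (1 + / L))) * ((1 + 2 / L) * (s * M)) =
    (1 + / L) * (1 + 2 * (rate2 * (1 + / L))) * (rate2 * ((1 + 2 / L) * (s * M))) by ring.
  rewrite rate2_mul.
  have -> : (1 + 2 / L) * L = L + 2 by field; lra.
  have h1 : 2 * (rate2 * (1 + / L)) <= / L / 400 by rewrite E3 in r1; nra.
  have h2 : (1 + / L) * (1 + 2 * (rate2 * (1 + / L))) <= 1 + / L * (1 + / 200) by nra.
  apply: (Rle_trans _ ((1 + / L * (1 + / 200)) * (L + 2))).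
    by apply: Rmult_le_compat_r; lra.
  nra.
set X := exp _.
have X1 : / (81 * s) <= X.
  apply: (Rle_trans _ (exp (- (L + 4)))); last by apply: exp_le; lra.
  have -> : exp (- (L + 4)) = / (exp 4 * s) by rewrite exp_Ropp exp_plus -sE Rmult_comm.
  apply: Rinv_le_contravar; first by apply: Rmult_lt_0_compat; [exact: exp_pos | lra].
  by apply: Rmult_le_compat_r; [lra | exact: exp4_le].
have [_ M0] := M_ge L1000; rewrite -/M in M0.
have sM0 : 0 < s * M by apply: Rmult_lt_0_compat; lra.
apply: (Rle_trans _ (/ (42 * (L * L)) * (s * M / 2) * / (81 * s))).
  have -> : / (42 * (L * L)) * (s * M / 2) * / (81 * s) = 320 / (42 * 162) * (L * L).
    by rewrite /M /density; field; lra.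
  have : 1000 * L <= L * L by apply: Rmult_le_compat_r; lra.
  lra.
apply: Rmult_le_compat => //.
- apply: Rmult_le_pos; last by lra.
  by apply/Rlt_le/Rinv_0_lt_compat; nra.
- by apply/Rlt_le/Rinv_0_lt_compat; nra.
- apply: Rmult_le_compat => //; last by lra.
  by apply/Rlt_le/Rinv_0_lt_compat; nra.
Qed.

(** There are at most (s+1)^j chains in a class, each surviving with probability at most (C/s)^j;
    division by j^j leaves at most e^(-j), since j >= 20000 outweighs the constants. *)
Lemma second_moment :
  ((s + 1) / INR j) ^ j *
    exp (rate2 * INR j - rate2 * (INR j * (d0 - (s + 1) - INR j * (s + 1)))) <= exp (- (20 * L)).
Proof.
have [i0 [i1 iL]] := invL; have r0 := rate2_ge0; have [rj _] := rate2_small; have hs := s_ge L1000 sE.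
have jp : 0 < INR j by lra.
have pow_exp e n : exp e ^ n = exp (INR n * e).
  elim: n => [|n IH]; first by rewrite /= Rmult_0_l exp_0.
  by rewrite S_INR /= IH -exp_plus; congr exp; ring.
have rd : rate2 * d0 = L - 1 by rewrite /d0 rate2_mul; lra.
have -> : rate2 * INR j - rate2 * (INR j * (d0 - (s + 1) - INR j * (s + 1))) =
   INR j * (rate2 * (1 + (INR j + 1) * (s + 1)) - rate2 * d0) by ring.
rewrite -pow_exp -Rpow_mult_distr.
apply: (Rle_trans _ (exp (- 1) ^ j)); last first.
  by rewrite pow_exp; apply: exp_le; lra.
apply: pow_incr; split.
  apply: Rmult_le_pos; last exact/Rlt_le/exp_pos.
  by apply/Rlt_le/Rdiv_lt_0_compat; lra.
apply: (Rle_trans _ ((s + 1) / INR j * exp (- L + 2))).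
  apply: Rmult_le_compat_l; first by apply/Rlt_le/Rdiv_lt_0_compat; lra.
  by apply: exp_le; lra.
have -> : exp (- L + 2) = exp 3 * / s * exp (- 1).
  by rewrite sE -!exp_Ropp -!exp_plus; congr exp; lra.
have e1 := exp_pos (- 1).
rewrite -Rmult_assoc -[X in _ <= X]Rmult_1_l; apply: Rmult_le_compat_r; first by lra.
have e3 : exp 3 <= 81 by apply: Rle_trans exp4_le; apply: exp_le; lra.
apply: (Rle_trans _ ((s + 1) / INR j * (81 * / s))).
  apply: Rmult_le_compat_l; first by apply/Rlt_le/Rdiv_lt_0_compat; lra.
  by apply: Rmult_le_compat_r => //; apply/Rlt_le/Rinv_0_lt_compat; lra.
have -> : (s + 1) / INR j * (81 * / s) = 81 * (s + 1) / (INR j * s) by field; lra.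
apply: (Rmult_le_reg_r (INR j * s)); first by apply: Rmult_lt_0_compat; lra.
have -> : 81 * (s + 1) / (INR j * s) * (INR j * s) = 81 * (s + 1) by field; lra.
have : 20000 * s <= INR j * s by apply: Rmult_le_compat_r; lra.
lra.
Qed.

End SecondRate.

(** * Stage 2 seen from one uncovered point and from one line through z *)

Section SecondStage.
Variables (Pt Ln : finType) (I : Pt -> Ln -> bool) (s t : nat) (L : R) (j : nat).
Hypotheses (gq : is_GQ I s t) (sparse : locally_sparse I s)
  (L1000 : 1000 <= L) (sE : INR s = exp L)
  (tup : INR t <= 2 * INR s ^ 2)
  (j20 : 20 * L <= INR j) (j21 : INR j <= 21 * L).
Notation perp := (perp I).
Notation pencil := (pencil I).
Let sR := INR s.
Let M := density L.
Let r2 := rate2 sR L.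
Let N_sym := perp_sym I.
Variables (x y z : Pt).
Hypotheses (yx : y \notin perp x) (zx : z \notin perp x) (yz : y \notin perp z).
Variable (S : {set Pt}).
Hypothesis bal : balanced I s L x y z S.
Let U := ~: nbr perp S.
Let ls := restrict (pencil y) U.
Let lam := / L / (2 * INR j).
Let d0 := (1 - / L) * (sR * M).

Let hs : 1000 * L <= sR := s_ge L1000 sE.
Let M0 : 0 < M := proj2 (M_ge L1000).

Lemma r2_admissible B : admissible r2 (restrict (pencil y) B).
Proof.
have r0 := rate2_ge0 L1000 sE; have rs := rate2_s L1000 sE.
apply: (pencil_admissible gq) => //; rewrite -/sR /r2.
have : 0 <= rate2 sR L * sR by apply: Rmult_le_pos => //; lra.
set q := rate2 sR L * sR in rs *; move=> q0; nra.
Qed.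

Lemma r2_le4 : r2 <= / 4.
Proof.
have [_ [r1 _]] := rate2_small L1000 sE j21; apply: Rle_trans r1 _.
by apply: Rinv_le_contravar; lra.
Qed.

Lemma s1_small : sR + 1 <= / L * (sR * M).
Proof.
have [i0 [i1 iL]] := invL L1000; have Mb := density_big L1000; rewrite -/M in Mb.
have -> : / L * (sR * M) = sR * (/ L * M) by ring.
suff : 2 <= / L * M by nra.
apply: (Rle_trans _ (/ L * (1000 * (1000 * (320 * (L * L)))))); last first.
  by apply: Rmult_le_compat_l; lra.
have -> : / L * (1000 * (1000 * (320 * (L * L)))) = 320000000 * L by field; lra.
lra.
Qed.

Section Degrees.
Variable (a : Pt).
Hypotheses (aS : a \notin nbr perp S) (ax : a != x) (ay : a \notin perp y).

Lemma degree_ge : d0 <= mu ls (perp a).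
Proof.
have [lo _] := bal (mem_head _ _) aS ax ay; apply: Rle_trans lo _.
rewrite /ls (mu_pencil gq); apply/le_INR/leP/subset_leq_card/subsetP => u.
rewrite in_setD => /andP[uS]; rewrite in_setD in_setI => /andP[ux /andP[uy ua]].
rewrite !in_setI in_setD1 in_setC uS uy ua !andbT.
by apply: contra ay => /eqP <-; rewrite -perp_sym.
Qed.

(** The second 1/L pays for the at most s+1 neighbours in [perp x], about which [balanced] says
    nothing. *)
Lemma degree_le (B : {set Pt}) : B \subset U -> mu (restrict (pencil y) B) (perp a) <= (1 + 2 / L) * (sR * M).
Proof.
move=> BU; have [_ up] := bal (mem_head _ _) aS ax ay.
have ya : y != a by rewrite eq_sym; exact: (notin_perp_neq gq ay).
have yNx : y != x by exact: (notin_perp_neq gq yx).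
have c3 := le_INR _ _ (leP (card_triple sparse ya yNx ax)).
rewrite (mu_pencil gq) S_INR -/sR in c3 *.
set D := ((perp y :&: perp a) :\: perp x) :\: nbr perp S in up.
apply: (Rle_trans _ (INR #|D :|: (perp y :&: perp a :&: perp x)|)).
  apply/le_INR/leP/subset_leq_card/subsetP => u; rewrite !in_setI in_setD1.
  case/andP=> /andP[/andP[_ uy] uB] ua.
  have := subsetP BU _ uB; rewrite inE => uS.
  rewrite !in_setU !in_setD !in_setI uS uy ua /=; by case: (u \in perp x).
apply: (Rle_trans _ (INR #|D| + INR #|perp y :&: perp a :&: perp x|)).
  by rewrite -plus_INR; apply/le_INR/leP/leq_card_setU.
have := s1_small.
have -> : (1 + 2 / L) * (sR * M) = (1 + / L) * (sR * M) + / L * (sR * M) by field; lra.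
rewrite -/sR -/M in up; lra.
Qed.

Lemma degree_ge_filter v : v != y -> v != a ->
  d0 - (sR + 1) <= mu (restrict (pencil y) (U :&: ~: perp v)) (perp a).
Proof.
move=> vy va; have lo := degree_ge.
have ya : y != a by rewrite eq_sym; exact: (notin_perp_neq gq ay).
have yv : y != v by rewrite eq_sym.
have av : a != v by rewrite eq_sym.
have c3 := le_INR _ _ (leP (card_triple sparse ya yv av)).
rewrite S_INR -/sR in c3; rewrite /ls !(mu_pencil gq) in lo *.
set X := (perp y :\ y) :&: U :&: perp a in lo.
set Y := _ :&: perp a.
have : INR #|X| <= INR #|Y| + INR #|perp y :&: perp a :&: perp v|.
  rewrite -plus_INR; apply/le_INR/leP; apply: leq_trans (leq_card_setU _ _).
  apply/subset_leq_card/subsetP => u.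
  rewrite /X /Y in_setU !in_setI in_setD1 [u \in ~: perp v]in_setC.
  by case/andP=> /andP[/andP[-> ->] ->] ->; case: (u \in perp v).
lra.
Qed.

End Degrees.

Lemma codegree_le B a b : a != b -> a != y -> b != y ->
  mu (restrict (pencil y) B) (perp a :&: perp b) <= sR + 1.
Proof.
move=> ab ay by_; rewrite (mu_pencil gq) /sR -S_INR.
apply: Rle_trans (le_INR _ _ (leP (card_triple sparse ab ay by_))).
apply/le_INR/leP/subset_leq_card/subsetP => u; rewrite !in_setI in_setD1.
by case/andP=> /andP[/andP[_ ->] _] /andP[-> ->].
Qed.

Lemma mu_setT_le B : mu (restrict (pencil y) B) setT <= exp (5 * L).
Proof.
rewrite (mu_pencil gq); apply: Rle_trans (card_points_exp gq L1000 sE tup y).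
exact/le_INR/leP/max_card.
Qed.

Section Uncovered.
Variable (v : Pt).
Hypotheses (vS : v \notin nbr perp S) (vx : v != x) (vy : v != y) (vz : v \notin perp z).
Let A := (((perp z :&: perp v) :\: perp x) :\: nbr perp S) :\: perp y.
Let lsv := restrict (pencil y) (U :&: ~: perp v).

Lemma AP a : a \in A -> [/\ a \notin nbr perp S, a != x, a \notin perp y, a \in perp z & a \in perp v].
Proof.
rewrite in_setD => /andP[ay]; rewrite in_setD => /andP[aS].
rewrite in_setD => /andP[ax]; rewrite in_setI => /andP[az av]; split=> //.
exact: (notin_perp_neq gq ax).
Qed.

Lemma card_A2 : sR * M / 2 <= INR #|A|.
Proof.
have [lo _] := bal (b := z) (w := v) ltac:(by rewrite !inE eqxx orbT) vS vx vz.
have zv : z != v by rewrite eq_sym; exact: (notin_perp_neq gq vz).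
have zy : z != y by rewrite eq_sym; exact: (notin_perp_neq gq yz).
have c3 := le_INR _ _ (leP (card_triple sparse zv zy vy)).
rewrite S_INR -/sR in c3.
set D := _ :\: nbr perp S in lo.
have : INR #|D| <= INR #|A| + INR #|perp z :&: perp v :&: perp y|.
  rewrite -plus_INR; apply/le_INR/leP; apply: leq_trans (leq_card_setU _ _).
  apply/subset_leq_card/subsetP => u uD.
  rewrite in_setU /A in_setD uD; case: (boolP (u \in perp y)) => //= uy.
  by move: uD; rewrite in_setD => /andP[_]; rewrite in_setD !in_setI uy => /andP[_ ->].
have := s1_small; have [i0 [i1 iL]] := invL L1000.
have sM : 0 < sR * M by apply: Rmult_lt_0_compat; lra.
have : / L * (sR * M) <= / 1000 * (sR * M) by apply: Rmult_le_compat_r; lra.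
move: lo; rewrite -/sR -/M; lra.
Qed.

(** Only about M points of [A] are expected to survive, so [lam] has to be of order 1/L^2. A class
    may have s+1 points, far too many for [lower_tail] at this [lam]; hence the moment version. *)
Lemma second_stage_vertex :
  Ex r2 ls (fun T => ind (v \notin nbr perp T) *
    exp (lam * ((2 * INR j + 1) * (10 * L)) + - (lam * INR #|A :\: nbr perp T|)))
   <= exp (- (10 * L)).
Proof.
have adm : admissible r2 ls := r2_admissible U.
have admv : admissible r2 lsv := r2_admissible _.
have [lam0 lE1 lE2 lK _] := lam2_bounds L1000 j20 j21; rewrite -/lam in lam0 lE1 lE2 lK.
have [i0 [i1 iL]] := invL L1000.
have jp : 0 < INR j by lra.
have eta4 : 0 <= / L <= / 4 by lra.
have lam_eta : 0 < / L - INR j * lam by rewrite lE1; lra.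
have kills1 a l : a \in A -> l \in lsv -> (#|l :&: perp a| <= 1)%nat.
  by case/AP=> _ _ ay _ _; exact: (pencil_card1 gq ay).
have class_le l u : l \in lsv -> u \in l -> INR #|A :&: perp u| <= sR + 1.
  case/mapP=> k' /pencilP[m ym ->] ->; rewrite !inE => /andP[/andP[um uy] /andP[_ uv]].
  rewrite /sR -S_INR; apply: le_INR.
  have zv : z != v by rewrite eq_sym; exact: (notin_perp_neq gq vz).
  have zu : z != u.
    apply: contra yz => /eqP ->; rewrite inE; exact: (collinearP ym um).
  have vu : v != u by apply: contra uv => /eqP ->; exact: (collinear_refl gq).
  apply/leP; apply: leq_trans (card_triple sparse zv zu vu).
  apply/subset_leq_card/setSI/subsetP => a /AP[_ _ _ az av].
  by rewrite in_setI az av.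
have va a : a \in A -> v != a.
  by case/AP=> _ _ _ az _; apply: contra vz => /eqP ->.
have Hd a : a \in A -> mu lsv (perp a) <= (1 + 2 / L) * (sR * M).
  by case/AP=> aS ax ay _ _; apply: degree_le => //; exact: subsetIl.
have Hm l u J : l \in lsv -> u \in l -> J \in chains j (A :&: perp u) ->
   INR j * ((d0 - (sR + 1)) - INR j * (sR + 1)) <= mu lsv (nbr perp J).
  move=> _ _; apply: mu_nbr_chain; first by lra.
    move=> a; rewrite in_setI => /andP[aA _]; have [aS ax ay _ _] := AP aA.
    by apply: degree_ge_filter => //; exact: va.
  move=> a b; rewrite !in_setI => /andP[/AP[_ _ ay _ _] _] /andP[/AP[_ _ by_ _ _] _] ab.
  by apply: codegree_le => //; apply: (notin_perp_neq gq).
have tail := lower_tail_moment N_sym admv lam0 eta4 r2_le4 lam_eta kills1 class_le Hd Hm.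
set K := lam * _ in lK *.
apply: (Rle_trans _ (Ex r2 lsv (fun T => exp K * exp (- (lam * INR #|A :\: nbr perp T|))))).
  rewrite /lsv -restrictI; apply: Rle_trans (Ex_restrict (perp v) adm _); last first.
    by move=> T; apply: Rmult_le_pos; exact/Rlt_le/exp_pos.
  by apply: Ex_le => // T; rewrite disjoint_nbr // -exp_plus; lra.
rewrite ExZ.
have main := second_main L1000 sE j20 j21 card_A2; rewrite -/lam -/sR -/r2 -/M in main.
have mom := second_moment L1000 sE j20 j21; rewrite -/d0 -/sR -/r2 in mom.
have ratioE : (sR + 1) * lam / (/ L - INR j * lam) = (sR + 1) / INR j.
  by rewrite lE1 /lam; field; lra.
rewrite ratioE in tail.
(* The threshold shifts the exponent by at most 11 ([lK]); the main term is at most e^(-20L) and the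
   moment term at most e^(5L) e^(-20L). *)
apply: (Rle_trans _ (exp 11 * (exp (- (20 * L)) + exp (5 * L) * exp (- (20 * L))))).
  apply: Rmult_le_compat.
  - exact/Rlt_le/exp_pos.
  - rewrite -(Ex_const r2 lsv 0); apply: Ex_le => // T; exact/Rlt_le/exp_pos.
  - exact: exp_le.
  apply: Rle_trans tail _; apply: Rplus_le_compat; first by apply: exp_le; lra.
  rewrite Rmult_assoc; apply: Rmult_le_compat => //.
  - exact: mu_ge0.
  - apply: Rmult_le_pos; last exact/Rlt_le/exp_pos.
    by apply/pow_le/Rlt_le/Rdiv_lt_0_compat; lra.
  - exact: mu_setT_le.
have h1 : exp (- (20 * L)) <= exp (5 * L) * exp (- (20 * L)).
  by rewrite -exp_plus; apply: exp_le; lra.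
apply: (Rle_trans _ (exp 11 * (exp 1 * (exp (5 * L) * exp (- (20 * L)))))).
  apply: Rmult_le_compat_l; first exact/Rlt_le/exp_pos.
  have := exp_ineq1_le 1; set q := _ * exp (- _) in h1 *.
  have : 0 <= q by apply: Rmult_le_pos; exact/Rlt_le/exp_pos.
  nra.
by rewrite -!exp_plus; apply: exp_le; lra.
Qed.

End Uncovered.

(** If more than 2j points of the line survive, at least j^j chains of length j survive, so the
    normalised count detects a bad line. Points of [perp y] are set aside because stage 2 does not
    control them; there is at most one per line. *)
Lemma second_stage_line (k : {set Pt}) : k \in pencil z ->
  Ex r2 ls (fun T => / INR j ^ j *
    \rsum_(J <- chains j ((k :&: U) :\: perp y)) ind (J \subset ~: nbr perp T)) <= exp (- (10 * L)).
Proof.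
move=> kz; have adm : admissible r2 ls := r2_admissible U.
have jp : 0 < INR j by lra.
have r0 := rate2_ge0 L1000 sE; rewrite -/sR -/r2 in r0.
set C := _ :\: perp y.
have CP a : a \in C -> [/\ a \notin nbr perp S, a != x & a \notin perp y].
  rewrite in_setD in_setI in_setC => /andP[ay /andP[ak aS]]; split=> //.
  apply: contra zx => /eqP <-; move: ak; case/pencilP: kz => l zl ->.
  by rewrite !inE => /andP[al _]; exact: (collinearP zl al).
have cC : INR #|C| <= sR + 1.
  apply: (Rle_trans _ (INR s)); last by rewrite -/sR; lra.
  case/pencilP: kz => l zl kE; rewrite -(card_line_minus gq zl) -kE.
  apply/le_INR/leP/subset_leq_card.
  exact: subset_trans (subsetDl _ _) (subsetIl _ _).
rewrite ExZ Ex_sum.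
have Hm J : J \in chains j C -> INR j * ((d0 - (sR + 1)) - INR j * (sR + 1)) <= mu ls (nbr perp J).
  apply: mu_nbr_chain; first by lra.
    by move=> a /CP[aS ax ay]; have := degree_ge aS ax ay; lra.
  move=> a b /CP[_ _ ay] /CP[_ _ by_] ab.
  by apply: codegree_le => //; apply: (notin_perp_neq gq).
set m := INR j * _ in Hm.
apply: (Rle_trans _ (/ INR j ^ j * ((sR + 1) ^ j * exp (r2 * INR j - r2 * m)))).
  apply: Rmult_le_compat_l; first exact/Rlt_le/Rinv_0_lt_compat/pow_lt.
  apply: (Rle_trans _ (\rsum_(J <- chains j C) exp (r2 * INR j - r2 * m))).
    rewrite big_seq_cond [X in _ <= X]big_seq_cond; apply: rsum_le => J; rewrite andbT => JC.
    apply: (Rle_trans _ (Ex r2 ls (fun T => ind [disjoint T & nbr perp J]))).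
      apply: Ex_le => // T; rewrite disjoint_nbr_sym // disjoints_subset; exact: Rle_refl.
    apply: Rle_trans (Ex_disjoint _ adm) _; apply: exp_le.
    have := Rmult_le_compat_l _ _ _ r0 (Hm J JC); rewrite -/(mu _ _).
    have : 0 <= r2 * INR j by apply: Rmult_le_pos; lra.
    lra.
  rewrite rsum_const count_predT; apply: Rmult_le_compat_r; first exact/Rlt_le/exp_pos.
  apply: Rle_trans (size_chains _ _) _; apply: pow_incr; split=> //; exact: pos_INR.
have mom := second_moment L1000 sE j20 j21; rewrite -/d0 -/sR -/r2 -/m in mom.
apply: (Rle_trans _ (exp (- (20 * L)))); last by apply: exp_le; lra.
apply: Rle_trans mom; apply: Req_le.
by rewrite /Rdiv Rpow_mult_distr pow_inv; ring.
Qed.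

End SecondStage.

(** * Stages 2 and 3: choice of T and R *)

Section LastStages.
Variables (Pt Ln : finType) (I : Pt -> Ln -> bool) (s t : nat) (L : R) (j : nat).
Hypotheses (gq : is_GQ I s t) (sparse : locally_sparse I s)
  (L1000 : 1000 <= L) (sE : INR s = exp L)
  (tup : INR t <= 2 * INR s ^ 2)
  (j20 : 20 * L <= INR j) (j21 : INR j <= 21 * L).
Notation perp := (perp I).
Notation pencil := (pencil I).
Let sR := INR s.
Let M := density L.
Let r2 := rate2 sR L.
Let N_sym := perp_sym I.
Variables (x y z : Pt).
Hypotheses (yx : y \notin perp x) (zx : z \notin perp x) (yz : y \notin perp z).
Variable (S : {set Pt}).
Hypotheses
  (P_le : forall b, b \in [:: y; z] -> INR #|(perp b :\: perp x) :\: nbr perp S| <= 16 * (sR * (sR * M)))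
  (bal : balanced I s L x y z S).
Let U := ~: nbr perp S.
Let ls := restrict (pencil y) U.
Let lam := / L / (2 * INR j).
Let hs : 1000 * L <= sR := s_ge L1000 sE.
Let M0 : 0 < M := proj2 (M_ge L1000).
Let B := (perp z :\: perp y) :&: U.
Let A v := (((perp z :&: perp v) :\: perp x) :\: nbr perp S) :\: perp y.

(** Stage 1 bounds the part off [perp x]; the t+1 points inside number at most 3 s^2, below the
    remaining 4 s^2 M. *)
Lemma card_perpU_le b : b \in [:: y; z] -> INR #|perp b :&: U| <= 20 * (sR * (sR * M)).
Proof.
move=> bb; have bx : b \notin perp x by move: bb; rewrite in_cons mem_seq1 => /orP[] /eqP ->.
have h := P_le bb; have Mb := density_big L1000; rewrite -/M in Mb.
have c : INR #|perp x :&: perp b| <= 3 * (sR * sR).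
  rewrite (card_common gq bx) S_INR; move: tup; rewrite -/sR /= => tup'; nra.
have : INR #|perp b :&: U| <= INR #|(perp b :\: perp x) :\: nbr perp S| + INR #|perp x :&: perp b|.
  rewrite -plus_INR; apply/le_INR/leP; apply: leq_trans (leq_card_setU _ _).
  apply/subset_leq_card/subsetP => u; rewrite in_setU !in_setI !in_setD in_setC.
  by case/andP=> -> ->; case: (u \in perp x).
have s2 : 0 <= sR * sR by exact: Rle_0_sqr.
have : 1 * (sR * sR) <= M * (sR * sR) by apply: Rmult_le_compat_r => //; nra.
lra.
Qed.

Lemma second_stage : exists T, [/\ outcome ls T,
  INR #|T| <= 160 * (L * sR),
  INR #|B :\: nbr perp T| <= 480 * (sR * M),
  forall v, v \notin nbr perp S -> v != x -> v != y -> v \notin perp z -> v \notin nbr perp T ->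
    (2 * INR j + 1) * (10 * L) <= INR #|A v :\: nbr perp T| &
  forall k, k \in pencil z -> INR #|((k :&: U) :\: perp y) :\: nbr perp T| <= 2 * INR j].
Proof.
have adm : admissible r2 ls := r2_admissible gq L1000 sE y U.
have [lam0 _ _ _ lam1] := lam2_bounds L1000 j20 j21; rewrite -/lam in lam0 lam1.
have r0 := rate2_ge0 L1000 sE; rewrite -/sR -/r2 in r0.
have [i0 [i1 iL]] := invL L1000.
have jp : 0 < INR j by lra.
have lamp : 0 < lam by apply: Rdiv_lt_0_compat; lra.
have sM0 : 0 < sR * M by apply: Rmult_lt_0_compat; lra.
have Ls0 : 0 < L * sR by apply: Rmult_lt_0_compat; lra.
pose K := (2 * INR j + 1) * (10 * L).
pose V := [set v | [&& v \notin nbr perp S, v != x, v != y & v \notin perp z]].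
pose G v (T : {set Pt}) := ind (v \notin nbr perp T) * exp (lam * K + - (lam * INR #|A v :\: nbr perp T|)).
pose H (k T : {set Pt}) := / INR j ^ j *
    \rsum_(J <- chains j ((k :&: U) :\: perp y)) ind (J \subset ~: nbr perp T).
have G0 v T : 0 <= G v T by apply: Rmult_le_pos; [exact: ind_ge0 | exact/Rlt_le/exp_pos].
have ij0 : 0 < / INR j ^ j by exact/Rinv_0_lt_compat/pow_lt.
have H0 k T : 0 <= H k T.
  by apply: Rmult_le_pos; [lra | apply: rsum_ge0 => J _; exact: ind_ge0].
(* Four nonnegative terms of expectation at most 1/8 each; both size thresholds are eight times the
   bounds on the means. *)
pose F (T : {set Pt}) := / (160 * (L * sR)) * INR #|T| +
  (/ (480 * (sR * M)) * INR #|B :\: nbr perp T| +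
  (\rsum_(v in V) G v T + \rsum_(k <- pencil z) H k T)).
have ET : Ex r2 ls (fun T => INR #|T|) <= 20 * (L * sR).
  apply: Rle_trans (Ex_card adm) _.
  have -> : \rsum_(l <- ls) INR #|l| = mu ls setT.
    by apply: eq_bigr => l _; rewrite setIT.
  rewrite /ls (mu_pencil gq) setIT.
  apply: (Rle_trans _ (r2 * ((20 * sR) * (sR * M)))); last by rewrite rate2_mul //; lra.
  apply: Rmult_le_compat_l => //; rewrite Rmult_assoc.
  apply: Rle_trans (card_perpU_le (mem_head _ _)).
  exact/le_INR/leP/subset_leq_card/setSI/subsetDl.
have EB : Ex r2 ls (fun T => INR #|B :\: nbr perp T|) <= 60 * (sR * M).
  apply: Rle_trans (Ex_survivors (d := (1 - / L) * (sR * M)) N_sym adm _) _.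
    move=> a; rewrite in_setI in_setD in_setC => /andP[/andP[ay az] aS].
    apply: (degree_ge gq bal aS) => //.
    by apply: contra zx => /eqP <-; rewrite -perp_sym.
  rewrite rate2_mul //.
  have -> : exp (- ((1 - / L) * L)) = exp 1 * / sR.
    rewrite /sR sE -exp_Ropp -exp_plus; congr exp; lra.
  apply: (Rle_trans _ (20 * (sR * (sR * M)) * (3 * / sR))).
    apply: Rmult_le_compat.
    - exact: pos_INR.
    - by apply: Rmult_le_pos; [exact/Rlt_le/exp_pos | apply/Rlt_le/Rinv_0_lt_compat; lra].
    - apply: Rle_trans (card_perpU_le (b := z) _); last by rewrite !inE eqxx orbT.
      exact/le_INR/leP/subset_leq_card/setSI/subsetDl.
    - apply: Rmult_le_compat_r; last exact: exp_le_3.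
      by apply/Rlt_le/Rinv_0_lt_compat; lra.
  by apply: Req_le; field; lra.
have small : exp (5 * L) * exp (- (10 * L)) <= / 8.
  have -> : exp (5 * L) * exp (- (10 * L)) = / exp (5 * L).
    by rewrite -exp_plus -exp_Ropp; congr exp; lra.
  by apply: Rinv_le_contravar; [lra | have := exp_ineq1_le (5 * L); lra].
have EG : Ex r2 ls (fun T => \rsum_(v in V) G v T) <= / 8.
  rewrite Ex_sum; apply: Rle_trans small.
  apply: (Rle_trans _ (\rsum_(v in V) exp (- (10 * L)))).
    apply: rsum_le => v; rewrite inE => /and4P[vS vx vy vz].
    exact: (second_stage_vertex gq sparse L1000 sE tup j20 j21 yx yz bal vS vx vy vz).
  rewrite rsum_set_const; apply: Rmult_le_compat_r; first exact/Rlt_le/exp_pos.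
  apply: Rle_trans (card_points_exp gq L1000 sE tup x); exact/le_INR/leP/max_card.
have EH : Ex r2 ls (fun T => \rsum_(k <- pencil z) H k T) <= / 8.
  rewrite Ex_sum; apply: Rle_trans small.
  apply: (Rle_trans _ (\rsum_(k <- pencil z) exp (- (10 * L)))).
    rewrite big_seq_cond [X in _ <= X]big_seq_cond; apply: rsum_le => k; rewrite andbT => kz.
    exact: (second_stage_line gq sparse L1000 sE j20 j21 zx bal kz).
  rewrite rsum_const count_predT (size_pencil gq); apply: Rmult_le_compat_r; first exact/Rlt_le/exp_pos.
  apply: Rle_trans (card_points_exp gq L1000 sE tup x).
  by rewrite -(card_common gq yx); exact/le_INR/leP/max_card.
have EF : Ex r2 ls F < 1.
  rewrite /F !ExD !ExZ.
  have h1 : / (160 * (L * sR)) * Ex r2 ls (fun T => INR #|T|) <= / 8.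
    apply: (Rle_trans _ (/ (160 * (L * sR)) * (20 * (L * sR)))).
      by apply: Rmult_le_compat_l => //; apply/Rlt_le/Rinv_0_lt_compat; lra.
    by apply: Req_le; field; lra.
  have h2 : / (480 * (sR * M)) * Ex r2 ls (fun T => INR #|B :\: nbr perp T|) <= / 8.
    apply: (Rle_trans _ (/ (480 * (sR * M)) * (60 * (sR * M)))).
      by apply: Rmult_le_compat_l => //; apply/Rlt_le/Rinv_0_lt_compat; lra.
    by apply: Req_le; field; lra.
  lra.
have [T oT FT] := Ex_outcome adm EF; exists T.
have T1 : 0 <= / (160 * (L * sR)) * INR #|T|.
  by apply: Rmult_le_pos; [apply/Rlt_le/Rinv_0_lt_compat; lra | exact: pos_INR].
have T2 : 0 <= / (480 * (sR * M)) * INR #|B :\: nbr perp T|.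
  by apply: Rmult_le_pos; [apply/Rlt_le/Rinv_0_lt_compat; lra | exact: pos_INR].
have T3 : 0 <= \rsum_(v in V) G v T by apply: rsum_ge0.
have T4 : 0 <= \rsum_(k <- pencil z) H k T by apply: rsum_ge0.
have cancel c v : 0 < c -> / c * v < 1 -> v <= c.
  move=> c0 h; apply: Rlt_le; have := Rmult_lt_compat_l _ _ _ c0 h.
  by rewrite -Rmult_assoc Rinv_r; lra.
rewrite /F in FT; split=> //.
- by apply: cancel; lra.
- by apply: cancel; lra.
- move=> v vS vx vy vz vT.
  have : G v T < 1.
    apply: (Rle_lt_trans _ (\rsum_(v in V) G v T)); last by lra.
    by apply: (rsum_ge_term (F := fun v => G v T)) => //; rewrite inE vS vx vy.
  rewrite /G vT Rmult_1_l -[X in _ < X -> _]exp_0 => /exp_lt_inv h.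
  by apply: (Rmult_le_reg_l lam) => //; apply/Rlt_le/Rminus_lt; exact: h.
- move=> k kz; apply: Rnot_lt_le => big.
  have : H k T < 1.
    apply: (Rle_lt_trans _ (\rsum_(k <- pencil z) H k T)); last by lra.
    rewrite (big_rem k) //= -[X in X <= _]Rplus_0_r; apply: Rplus_le_compat_l.
    exact: rsum_ge0.
  suff : 1 <= H k T by lra.
  set C := (k :&: U) :\: perp y in big.
  (* Unit weights with eta = 2j: the base 2j - j = j gives exactly the j^j that normalises [H]. *)
  have := @chains_sum_ge _ (fun=> 1) 1 (2 * INR j) j C (~: nbr perp T) ltac:(lra) ltac:(move=> *; lra) ltac:(lra).
  rewrite -setDE rsum_set_const Rmult_1_r => /(_ (Rlt_le _ _ big)).
  have -> : 2 * INR j - INR j * 1 = INR j by ring.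
  move=> hc; rewrite /H -/C; apply: (Rmult_le_reg_l (INR j ^ j)); first exact: pow_lt.
  rewrite -Rmult_assoc Rinv_r ?Rmult_1_r ?Rmult_1_l; last by have := pow_lt _ j jp; lra.
  apply: Rle_trans hc _; apply: rsum_le => J _; rewrite big1 // Rmult_1_r; exact: Rle_refl.
Qed.

Lemma third_stage (T : {set Pt}) :
  (forall v, v \notin nbr perp S -> v != x -> v != y -> v \notin perp z -> v \notin nbr perp T ->
    (2 * INR j + 1) * (10 * L) <= INR #|A v :\: nbr perp T|) ->
  (forall k, k \in pencil z -> INR #|((k :&: U) :\: perp y) :\: nbr perp T| <= 2 * INR j) ->
  exists2 R0, outcome (restrict (pencil z) (U :&: ~: nbr perp T)) R0 &
    forall v, v \in U :&: ~: nbr perp T -> v != x -> v != y -> v \notin perp z -> v \in nbr perp R0.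
Proof.
move=> HA Hk; set W := U :&: ~: nbr perp T.
have jp : 0 < INR j by lra.
(* A line through z has at most 2j uncovered points off [perp y] and at most one in it, so this is
   an admissible rate. The target degree (2j+1) 10L makes the exponent 10L, and a first moment below
   1 leaves no uncovered target. *)
pose r3 := / (2 * INR j + 1).
have r3p : 0 < r3 by apply: Rinv_0_lt_compat; lra.
have adm : admissible r3 (restrict (pencil z) W).
  split; first by lra.
  move=> _ /mapP[k kz ->].
  have c1 : INR #|k :&: perp y| <= 1.
    apply: (le_INR _ 1); apply/leP.
    have := pencil_card1 (B := setT) (k := k) gq yz; apply.
    by apply/mapP; exists k; rewrite ?setIT.
  have : INR #|k :&: W| <= INR #|((k :&: U) :\: perp y) :\: nbr perp T| + INR #|k :&: perp y|.
    rewrite -plus_INR; apply/le_INR/leP; apply: leq_trans (leq_card_setU _ _).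
    apply/subset_leq_card/subsetP => u.
    rewrite in_setU !in_setD !in_setI [u \in ~: nbr perp T]in_setC.
    by case/and3P=> -> -> ->; case: (u \in perp y).
  have := Hk k kz => h1 h2.
  have h3 : r3 * INR #|k :&: W| <= r3 * (2 * INR j + 1) by apply: Rmult_le_compat_l; lra.
  by rewrite {2}/r3 Rinv_l in h3; lra.
pose V := [set v in W | [&& v != x, v != y & v \notin perp z]].
have EV : Ex r3 (restrict (pencil z) W) (fun R0 => INR #|V :\: nbr perp R0|) < 1.
  apply: Rle_lt_trans (Ex_survivors (d := (2 * INR j + 1) * (10 * L)) N_sym adm _) _.
    move=> v; rewrite inE in_setI !in_setC => /andP[/andP[vS vT] /and3P[vx vy vz]].
    apply: Rle_trans (HA v vS vx vy vz vT) _; rewrite (mu_pencil gq).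
    apply/le_INR/leP/subset_leq_card/subsetP => u.
    rewrite in_setD => /andP[uT]; rewrite in_setD => /andP[uy].
    rewrite in_setD => /andP[uS]; rewrite in_setD in_setI => /andP[ux /andP[uz uv]].
    rewrite !in_setI in_setD1 !in_setC uS uT uz uv !andbT.
    by apply: contra vz => /eqP <-; rewrite -perp_sym.
  have -> : r3 * ((2 * INR j + 1) * (10 * L)) = 10 * L by rewrite /r3; field; lra.
  apply: (Rle_lt_trans _ (exp (5 * L) * exp (- (10 * L)))).
    apply: Rmult_le_compat_r; first exact/Rlt_le/exp_pos.
    apply: Rle_trans (card_points_exp gq L1000 sE tup x); exact/le_INR/leP/max_card.
  by rewrite -exp_plus -exp_0; apply: exp_increasing; lra.
have [R0 oR VR] := Ex_outcome adm EV; exists R0 => // v vW vx vy vz.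
apply: contraTT (isT) => vR; exfalso.
suff : 1 <= INR #|V :\: nbr perp R0| by lra.
apply: (le_INR 1); apply/leP/card_gt0P; exists v.
by rewrite in_setD vR inE vW vx vy.
Qed.

End LastStages.

(** * Extension to a maximal partial ovoid, and the final count *)

Section Assembly.
Variables (Pt Ln : finType) (I : Pt -> Ln -> bool).
Implicit Types O : {set Pt}.

Definition partial_ovoidb O :=
  [forall a in O, forall b in O, (a != b) ==> ~~ collinear I a b].

Lemma partial_ovoidP O : reflect (partial_ovoid I O) (partial_ovoidb O).
Proof.
apply: (iffP idP) => [/forall_inP H a b aO bO ab|H].
  by have /forall_inP/(_ b bO) := H a aO; rewrite ab.
by apply/forall_inP => a aO; apply/forall_inP => b bO; apply/implyP; exact: H.
Qed.

Lemma maximal_extension O : partial_ovoid I O ->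
  exists2 O', maximal_partial_ovoid I O' & O \subset O'.
Proof.
move=> /partial_ovoidP pO; have [O' maxO' sO] := maxset_exists pO; exists O' => //.
have [/partial_ovoidP pO' maxP] := maxsetP maxO'; split=> // O2 /properP[s2 [a aO2 aO']].
by move=> /partial_ovoidP/maxP/(_ s2) E; rewrite -E aO2 in aO'.
Qed.

End Assembly.

Lemma nat_between r : 0 <= r -> exists n : nat, r <= INR n <= r + 1.
Proof.
move=> r0; have [h1 h2] := archimed r; exists (Z.to_nat (up r)).
have up0 : (0 <= up r)%Z by apply: le_IZR; lra.
by rewrite INR_IZR_INZ Znat.Z2Nat.id //; lra.
Qed.

Lemma small_maximal_partial_ovoid (Pt Ln : finType) (I : Pt -> Ln -> bool) (s t : nat) (L : R) (p : Pt) :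
  is_GQ I s t -> locally_sparse I s -> 1000 <= L -> INR s = exp L -> INR s * L ^ 8 <= INR t ->
  exists2 O, maximal_partial_ovoid I O & INR #|O| <= INR s * (160000 * L ^ 4).
Proof.
move=> gq sparse L1000 sE tlow.
have [x [y [z [xy xz yz]]]] := three_noncollinear gq p.
have yx : y \notin perp I x by rewrite -perp_sym.
have zx : z \notin perp I x by rewrite -perp_sym.
have tup : INR t <= 2 * INR s ^ 2.
  apply: Rle_trans (le_INR _ _ (leP (order_le gq sparse xy))) _.
  by rewrite !mult_INR /=; lra.
have [j [j20 j21]] := nat_between (r := 20 * L) ltac:(lra).
have {}j21 : INR j <= 21 * L by lra.
have [S [oS cS P_le Q_le bal]] := first_stage gq sparse L1000 sE tlow tup yx zx yz.
have [T [oT cT cB HA Hk]] := second_stage gq sparse L1000 sE tup j20 j21 yx zx yz P_le bal.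
have [R0 oR HR] := third_stage gq L1000 sE tup j20 yz HA Hk.
have hs := s_ge L1000 sE; have Mb := density_big L1000; have [_ M0] := M_ge L1000.
have col_sym : symmetric (collinear I) := collinear_sym I.
have TU u : u \in T -> u \notin nbr (perp I) S.
  by case/(outcome_subset oT)=> _ /mapP[k _ ->]; rewrite in_setI in_setC => /andP[].
have RU u : u \in R0 -> [/\ u \notin nbr (perp I) S, u \notin nbr (perp I) T & u \in perp I z].
  case/(outcome_subset oR)=> _ /mapP[k /pencilP[l zl ->] ->].
  rewrite !in_setI !in_setC => /andP[uk /andP[uS uT]]; split=> //.
  by move: uk; rewrite !inE => /andP[ul _]; exact: collinearP ul zl.
have nbr_free (D : {set Pt}) u v : u \notin nbr (perp I) D -> v \in D -> ~~ collinear I u v.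
  by move=> uD vD; apply: contra uD => uv; apply/bigcupP; exists v; rewrite // inE.
have pO : partial_ovoid I (S :|: T :|: R0).
  have pS := outcome_pairwise col_sym (pencil_pairwise gq x _) oS.
  have pT := outcome_pairwise col_sym (pencil_pairwise gq y _) oT.
  have pR := outcome_pairwise col_sym (pencil_pairwise gq z _) oR.
  move=> a b; rewrite !in_setU => /orP[/orP[aS|aT]|aR] /orP[/orP[bS|bT]|bR] ab.
  - exact: pS.
  - by rewrite col_sym; exact: nbr_free (TU _ bT) aS.
  - by rewrite col_sym; have [h _ _] := RU _ bR; exact: nbr_free h aS.
  - exact: nbr_free (TU _ aT) bS.
  - exact: pT.
  - by rewrite col_sym; have [_ h _] := RU _ bR; exact: nbr_free h aT.
  - by have [h _ _] := RU _ aR; exact: nbr_free h bS.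
  - by have [_ h _] := RU _ aR; exact: nbr_free h bT.
  - exact: pR.
have [O mO sO] := maximal_extension pO; exists O => //.
have [indO _] := mO.
pose W := ~: nbr (perp I) S :&: ~: nbr (perp I) T.
have avoid (D : {set Pt}) a : D \subset O -> a \in O -> a \notin D -> a \notin nbr (perp I) D.
  move=> DO aO aD; apply/negP => /bigcupP[u uD]; rewrite inE; apply/negP.
  apply: indO => //; first exact: (subsetP DO).
  by apply: contra aD => /eqP ->.
have SO : S \subset O by apply: subset_trans sO; rewrite -setUA subsetUl.
have TO : T \subset O by apply: subset_trans sO; rewrite setUAC subsetUr.
have RO : R0 \subset O by apply: subset_trans sO; rewrite subsetUr.
set B := (perp I z :\: perp I y) :&: ~: nbr (perp I) S in cB.
set Q := (_ :\: perp I x) :\: nbr (perp I) S in Q_le.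
(* A point of [perp z] is counted in [B] when it is off [perp y], having been thinned by stage 2; in
   [Q] when it is in [perp y] but off [perp x], thinned by stage 1 only; and otherwise in the triple
   intersection. Off [perp z], the set [R0] covers everything but x and y. *)
have cover : O \subset S :|: (T :|: ((B :\: nbr (perp I) T) :|:
    (Q :|: ((perp I y :&: perp I z :&: perp I x) :|: [set x; y])))).
  apply/subsetP => a aO; rewrite in_setU; case: (boolP (a \in S)) => //= aS.
  rewrite in_setU; case: (boolP (a \in T)) => //= aT.
  have aS' := avoid _ _ SO aO aS; have aT' := avoid _ _ TO aO aT.
  rewrite !in_setU !in_set1 /B /Q !in_setD !in_setI !in_setC aS' aT' /= andbT.
  case: (boolP (a == x)) => [|ax]; first by rewrite !orbT.
  case: (boolP (a == y)) => [|ay]; first by rewrite !orbT.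
  case: (boolP (a \in perp I z)) => az; last first.
    have aR : a \notin R0 by apply: contra az => /RU[].
    have := avoid _ _ RO aO aR; rewrite HR //.
    by rewrite in_setI !in_setC aS' aT'.
  by rewrite in_setD az; case: (a \in perp I y); case: (a \in perp I x).
have c3 : INR #|perp I y :&: perp I z :&: perp I x| <= INR s + 1.
  rewrite -S_INR; apply/le_INR/leP/card_triple => //.
  - exact: (notin_perp_neq gq yz).
  - exact: (notin_perp_neq gq yx).
  - exact: (notin_perp_neq gq zx).
have c2 : INR #|[set x; y]| <= 2.
  by apply: (le_INR _ 2); rewrite cards2; case: (_ != _); lia.
have cardU (C D : {set Pt}) : INR #|C :|: D| <= INR #|C| + INR #|D|.
  by rewrite -plus_INR; apply/le_INR/leP/leq_card_setU.
apply: Rle_trans (le_INR _ _ (leP (subset_leq_card cover))) _.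
apply: Rle_trans (cardU _ _) _.
have := cardU T ((B :\: nbr (perp I) T) :|:
    (Q :|: ((perp I y :&: perp I z :&: perp I x) :|: [set x; y]))).
have := cardU (B :\: nbr (perp I) T) (Q :|: ((perp I y :&: perp I z :&: perp I x) :|: [set x; y])).
have := cardU Q ((perp I y :&: perp I z :&: perp I x) :|: [set x; y]).
have := cardU (perp I y :&: perp I z :&: perp I x) [set x; y].
have sM : 1000 * (L * INR s) <= INR s * density L.
  rewrite -Rmult_assoc Rmult_comm; apply: Rmult_le_compat_l; first by lra.
  by apply: Rle_trans Mb; nra.
have sL : INR s <= L * INR s by nra.
(* The parts add up to (480 + 16) sM + (8 + 160) Ls + s + 3, at most 500 sM because sM >= 1000
   Ls. *)
have -> : INR s * (160000 * L ^ 4) = 500 * (INR s * density L) by rewrite /density; ring.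
lra.
Qed.

Lemma small_ovoid_of_large_order :
  forall alpha : R, (4 < alpha) ->
  exists s0 : nat,
  forall (Pt Ln : finType) (I : Pt -> Ln -> bool) (s t : nat),
    is_GQ I s t ->
    locally_sparse I s ->
    (s0 <= s)%nat ->
    (INR s * Rpower (ln (INR s)) (2 * alpha) <= INR t) ->
    exists O : {set Pt},
      maximal_partial_ovoid I O /\
      (INR #|O| <= INR s * Rpower (ln (INR s)) alpha).
Proof.
(* The second bound makes L^(alpha - 4) at least e^18, and e^18 >= 2^18 = 262144 exceeds the
   constant 160000. *)
move=> alpha alpha4; pose L0 := Rmax 1000 (exp (18 / (alpha - 4))).
have [s0 [s0L _]] := nat_between (r := exp L0) (Rlt_le _ _ (exp_pos _)).
exists s0 => Pt Ln I s t gq sparse s0s tlow.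
have sL : exp L0 <= INR s by apply: Rle_trans s0L _; apply/le_INR/leP.
have s_gt0 : 0 < INR s by have := exp_pos L0; lra.
set L := ln (INR s) in tlow *.
have LL0 : L0 <= L by rewrite -(ln_exp L0); apply: ln_le => //; exact: exp_pos.
have L1000 : 1000 <= L by apply: Rle_trans LL0; exact: Rmax_l.
have Lexp : exp (18 / (alpha - 4)) <= L by apply: Rle_trans LL0; exact: Rmax_r.
have L_gt0 : 0 < L by lra.
have powE n : Rpower L (INR n) = L ^ n by exact: Rpower_pow.
have R0 : 0 < Rpower L alpha by exact: exp_pos.
(* Without points the empty set is the ovoid; otherwise some point is available to start from. *)
have [p _|noPt] := pickP (mem [set: Pt]); last first.
  exists set0; split; last by rewrite cards0; apply: Rmult_le_pos; lra.
  split=> [a b|O /properP[_ [a _ _]]]; first by rewrite inE.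
  by have := noPt a; rewrite /= inE.
have tlow8 : INR s * L ^ 8 <= INR t.
  apply: Rle_trans tlow; apply: Rmult_le_compat_l; first by lra.
  by rewrite -powE; apply: Rle_Rpower; rewrite /=; lra.
have sE : INR s = exp L by rewrite exp_ln.
have [O mO cO] := small_maximal_partial_ovoid p gq sparse L1000 sE tlow8.
exists O; split=> //; apply: Rle_trans cO _; apply: Rmult_le_compat_l; first by lra.
have -> : alpha = (alpha - 4) + INR 4 by rewrite /=; lra.
rewrite Rpower_plus powE; apply: Rmult_le_compat_r; first by apply: pow_le; lra.
have lnL : 18 / (alpha - 4) <= ln L.
  by rewrite -[X in X <= _]ln_exp; apply: ln_le => //; exact: exp_pos.
apply: (Rle_trans _ (exp 18)); last first.
  apply: exp_le; have := Rmult_le_compat_l (alpha - 4) _ _ ltac:(lra) lnL.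
  by have -> : (alpha - 4) * (18 / (alpha - 4)) = 18 by field; lra.
have -> : exp 18 = exp 1 ^ 18.
  by rewrite -Rpower_pow ?/Rpower ?ln_exp; [congr exp; rewrite /=; lra | exact: exp_pos].
apply: (Rle_trans _ (2 ^ 18)); first by rewrite /=; lra.
by apply: pow_incr; have := exp_ineq1_le 1; lra.
Qed.

Close Scope R_scope.

Theorem theorem1 :
  forall alpha : R, (4 < alpha)%R ->
  exists s0 : nat,
  forall (Pt Ln : finType) (I : Pt -> Ln -> bool) (s t : nat),
    is_GQ I s t ->
    locally_sparse I s ->
    (s0 <= s)%N ->
    (INR s * Rpower (ln (INR s)) (2 * alpha) <= INR t)%R ->
    exists O : {set Pt},
      maximal_partial_ovoid I O /\
      (INR #|O| <= INR s * Rpower (ln (INR s)) alpha)%R.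
Proof. exact: small_ovoid_of_large_order. Qed.
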